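(* There is a universal constant $C>0$ such that for every (nonempty) family $\mathcal{P}$ of probability distributions on a common measurable space, $$\log\bigl(1+\chi^2(\mathcal{P})\bigr)\ \le\ C\Bigl(\sum_{k=1}^{\lfloor \mathsf{C}_{\chi^2}(\mathcal{P})\rfloor+1}\mathsf{D}_k(\mathcal{P})\;+\;\bigl(\mathsf{C}_{\chi^2}(\mathcal{P})+1\bigr)\,\log_+\!\bigl(\log \mathsf{C}_{\chi^2}(\mathcal{P})\bigr)\Bigr),$$ where $\log_+(x):=\log(\max\{x,e\})$, and $\chi^2(\mathcal{P})$, $\mathsf{C}_{\chi^2}(\mathcal{P})$, $\mathsf{D}_k(\mathcal{P})$ are the quantities defined in the context.
   Context: All logarithms are natural. For probability measures $P,Q$ on the same space, $\chi^2(P\|Q)=\int \frac{(dP-dQ)^2}{dQ}$ (equal to $+\infty$ if $P\not\ll Q$), $H^2(P,Q)=\int(\sqrt{dP}-\sqrt{dQ})^2$, and $D_{1/2}(P,Q)=-2\log\bigl(1-\tfrac{H^2(P,Q)}{2}\bigr)=-2\log\int\sqrt{dP\,dQ}\in[0,\infty]$ (Rényi divergence of order $1/2$). Given $P_1,\dots,P_n\in\mathcal{P}$, the permutation mixture is $\mathbb{P}_n=\frac{1}{n!}\sum_{\pi\in S_n}\bigotimes_{i=1}^n P_{\pi(i)}$ and its i.i.d. mean-field approximation is $\mathbb{Q}_n=\bigl(\frac1n\sum_{i=1}^n P_i\bigr)^{\otimes n}$. Define $$\chi^2(\mathcal{P})=\sup_{n\ge1}\ \sup_{P_1,\dots,P_n\in\mathcal{P}}\chi^2(\mathbb{P}_n\|\mathbb{Q}_n).$$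 The $\chi^2$ channel capacity is $$\mathsf{C}_{\chi^2}(\mathcal{P})=\sup_\rho\ \mathbb{E}_{\theta\sim\rho}\bigl[\chi^2\bigl(P_\theta\,\|\,\mathbb{E}_{\theta'\sim\rho}[P_{\theta'}]\bigr)\bigr],$$ where $(P_\theta)_\theta=\mathcal{P}$ is a parametrization of $\mathcal{P}$ and $\rho$ ranges over prior distributions of $\theta$. The Rényi partition diameter of order $k\in\mathbb{N}$, $k\ge1$, is $$\mathsf{D}_k(\mathcal{P})=\inf_{\mathcal{P}=\bigsqcup_{i=1}^k\mathcal{P}_i}\ \max_{i\in[k]}\ \sup_{P,Q\in\mathcal{P}_i}D_{1/2}(P,Q),$$ the infimum being over partitions of $\mathcal{P}$ into $k$ (possibly empty) subclasses, an empty class having diameter $0$. If $\log\mathsf{C}_{\chi^2}(\mathcal P)$ is less than $e$ (including $-\infty$), then $\log_+(\log\mathsf{C}_{\chi^2}(\mathcal P))=1$; both sides of the inequality may equal $+\infty$. *)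

(* Defs.v *)
From HB Require Import structures.
From mathcomp Require Import all_boot all_order all_fingroup all_algebra.
From mathcomp Require Import all_classical all_reals all_analysis.
From mathcomp Require Import measurable_realfun.

Set Implicit Arguments.
Unset Strict Implicit.
Unset Printing Implicit Defensive.
Import Order.TTheory GRing.Theory Num.Theory.
Import numFieldNormedType.Exports.

Local Open Scope classical_set_scope.
Local Open Scope ring_scope.
Local Open Scope charge_scope.
Local Open Scope ereal_scope.

Section product_probability.
Context d1 d2 (T1 : measurableType d1) (T2 : measurableType d2) (R : realType).
Variables (P1 : probability T1 R) (P2 : probability T2 R).

Definition product_probability : set (T1 * T2) -> \bar R := P1 \x P2.

HB.instance Definition _ := Measure.on product_probability.

Let product_probability_setT : product_probability setT = 1.
Proof.
rewrite /product_probability -setXTT.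
transitivity (P1 setT * P2 setT); first exact: product_measure1E.
by rewrite !probability_setT mule1.
Qed.

HB.instance Definition _ := Measure_isProbability.Build _ _ _
  product_probability product_probability_setT.

End product_probability.

Section tuple_cons.
Context d (T : measurableType d) (n : nat).

Definition tuple_cons (x : T * n.-tuple T) : n.+1.-tuple T :=
  [the n.+1.-tuple T of x.1 :: x.2].

Let measurable_tuple_cons : measurable_fun setT tuple_cons.
Proof. exact: measurable_cons. Qed.

HB.instance Definition _ :=
  isMeasurableFun.Build _ _ _ _ tuple_cons measurable_tuple_cons.

End tuple_cons.

Section tensor.
Context d (T : measurableType d) (R : realType).

Fixpoint tensor (n : nat) :
    ('I_n -> probability T R) -> probability (n.-tuple T) R :=
  match n with
  | 0 => fun=> \d_([tuple])
  | n'.+1 => fun P => distribution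
      (product_probability (P ord0) (tensor (fun i => P (lift ord0 i))))
      (@tuple_cons _ T n')
  end.

Lemma tensorE n (P : 'I_n -> probability T R) (A : 'I_n -> set T) :
    (forall i, measurable (A i)) ->
  tensor P [set t | forall i, A i (tnth t i)] = \prod_(i < n) P i (A i).
Proof.
elim: n P A => [|n IH] P A mA.
  rewrite big_ord0 /= diracE mem_set//.
  by case.
rewrite big_ord_recl -IH//.
have mB : measurable [set t : n.-tuple T | forall i, A (lift ord0 i) (tnth t i)].
  rewrite (_ : [set _ | _] =
    \bigcap_(i in [set: 'I_n])
      ((fun t : n.-tuple T => tnth t i) @^-1` A (lift ord0 i))).
    apply: fin_bigcap_measurable => // i _.
    by rewrite -[X in measurable X]setTI; exact: measurable_tnth.
  by apply/seteqP; split => t /= h i; [move=> _|]; exact: h.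
rewrite -[RHS]product_measure1E//.
rewrite /= /distribution /pushforward /product_probability.
congr (_ _); apply/seteqP; split => [[x t]|[x t]] /=.
  move=> h; split; first exact: (h ord0).
  by move=> i; have := h (lift ord0 i); rewrite tnthS.
by move=> [Ax h] i; have [j ->|->//] := unliftP ord0 i; rewrite tnthS.
Qed.

End tensor.

Section uniform_mixture.
Context d (T : measurableType d) (R : realType) (I : finType).

(* The element of [I] only witnesses that [I] is nonempty, so that the mixture
   is canonically a probability. *)
Definition uniform_mixture (_ : I) (P : I -> probability T R) (A : set T) :
    \bar R :=
  (#|I|%:R^-1)%:E * \sum_(i : I) P i A.

Variables (i0 : I) (P : I -> probability T R).
Local Notation mix := (uniform_mixture i0 P).

Let uniform_mixture0 : mix set0 = 0.
Proof.
by rewrite /uniform_mixture big1 ?mule0// => i _; rewrite measure0.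
Qed.

Let uniform_mixture_ge0 A : 0 <= mix A.
Proof. by rewrite mule_ge0// ?lee_fin// sume_ge0. Qed.

Let uniform_mixture_sigma_additive : semi_sigma_additive mix.
Proof.
move=> F mF tF mUF.
rewrite [X in X @ _ --> _](_ : _ = (fun n => (#|I|%:R^-1)%:E *
    \sum_(i : I) \sum_(0 <= k < n) P i (F k))); last first.
  apply/funext => n; rewrite /uniform_mixture exchange_big/=.
  by rewrite ge0_sume_distrr// => k _; exact: sume_ge0.
apply: cvgeZl => //.
apply: cvg_nnesum => [i _|i _].
  by near=> n; exact: sume_ge0.
exact: measure_semi_sigma_additive.
Unshelve. all: by end_near. Qed.

HB.instance Definition _ := isMeasure.Build _ _ _ mix
  uniform_mixture0 uniform_mixture_ge0 uniform_mixture_sigma_additive.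

Let uniform_mixture_setT : mix setT = 1.
Proof.
rewrite /uniform_mixture.
under eq_bigr do rewrite probability_setT.
rewrite sumEFin sumr_const -EFinM mulVf// pnatr_eq0 -lt0n.
by apply/card_gt0P; exists i0.
Qed.

HB.instance Definition _ := Measure_isProbability.Build _ _ _
  mix uniform_mixture_setT.

End uniform_mixture.

Section prior_mean.
Context d d' (T : measurableType d) (Th : measurableType d') (R : realType).
Variables (p : {mfun Th >-> pprobability T R}) (rho : probability Th R).

Definition prior_mean (A : set T) : \bar R :=
  \int[rho]_t (p t : probability T R) A.

Let mp : measurable_fun setT p. Proof. exact: measurable_funPT. Qed.

Let prior_mean0 : prior_mean set0 = 0.
Proof.
by rewrite /prior_mean; under eq_integral do rewrite measure0; rewrite integral0.
Qed.

Let prior_mean_ge0 A : 0 <= prior_mean A.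
Proof. exact: integral_ge0. Qed.

Let prior_mean_sigma_additive : semi_sigma_additive prior_mean.
Proof.
move=> F mF tF mUF.
have mpF n : measurable_fun setT
      ((fun t => (p t : probability T R) (F n)) : Th -> \bar R).
  exact: (measurable_kernel (kprobability mp) (F n) (mF n)).
rewrite [X in _ --> X](_ : _ = \sum_(n <oo) prior_mean (F n)).
  apply/cvg_closeP; split; last by rewrite closeE.
  by apply: is_cvg_nneseries => n _ _; exact: integral_ge0.
rewrite /prior_mean -integral_nneseries//.
apply: eq_integral => t _.
by apply/esym/cvg_lim => //; exact: measure_semi_sigma_additive.
Qed.

HB.instance Definition _ := isMeasure.Build _ _ _ prior_mean
  prior_mean0 prior_mean_ge0 prior_mean_sigma_additive.

Let prior_mean_setT : prior_mean setT = 1.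
Proof.
rewrite /prior_mean (eq_integral (cst 1)) => [|t _].
  transitivity (1 * rho setT); first exact: integral_cst.
  by rewrite probability_setT mule1.
exact: (@probability_setT _ _ _ (p t : probability T R)).
Qed.

HB.instance Definition _ := Measure_isProbability.Build _ _ _
  prior_mean prior_mean_setT.

End prior_mean.

Section measure_add_finite.
Context d (T : measurableType d) (R : realType).
Variables mu nu : {finite_measure set T -> \bar R}.

HB.instance Definition _ := Measure.on (measure_add mu nu).

Let measure_add_fin_num : fin_num_fun (measure_add mu nu).
Proof.
by move=> A mA; rewrite measure_addE fin_numD !fin_num_measure.
Qed.

HB.instance Definition _ :=
  @Measure_isFinite.Build _ T _ (measure_add mu nu) measure_add_fin_num.

End measure_add_finite.

Section divergences.
Context d (T : measurableType d) (R : realType).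
Implicit Types P Q : probability T R.

Definition chi2 P Q : \bar R :=
  if `[< P `<< Q >] then
    \int[Q]_x (('d (charge_of_finite_measure P) '/d Q) x - 1) ^+ 2
  else +oo.

(* [P + Q] is the common dominating measure; the integral does not depend on
   this choice. *)
Definition hellinger2 P Q : \bar R :=
  let mu := measure_add P Q in
  \int[mu]_x
    ((Num.sqrt (fine (('d (charge_of_finite_measure P) '/d mu) x)) -
      Num.sqrt (fine (('d (charge_of_finite_measure Q) '/d mu) x))) ^+ 2)%:E.

Definition renyi_half P Q : \bar R :=
  (- 2)%:E * lne (1 - hellinger2 P Q * (2^-1)%:E).

End divergences.

Section class_quantities.
Context d (T : measurableType d) (R : realType).
Implicit Type F : set (probability T R).

Definition permutation_mixture n (P : 'I_n -> probability T R) :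
    probability (n.-tuple T) R :=
  uniform_mixture (1%g : 'S_n) (fun s : 'S_n => tensor (fun i => P (s i))).

Definition mean_field n (P : 'I_n.+1 -> probability T R) :
    probability (n.+1.-tuple T) R :=
  tensor (fun=> uniform_mixture ord0 P).

Definition chi2_class F : \bar R :=
  ereal_sup [set x | exists n (P : 'I_n.+1 -> probability T R),
    (forall i, F (P i)) /\ x = chi2 (permutation_mixture P) (mean_field P)].

(* The parameter space may carry any sigma-algebra making the parametrization
   measurable for the sigma-algebra generated by the evaluations at measurable
   sets, so that the mean [prior_mean] makes sense. *)
Definition chi2_capacity F : \bar R :=
  ereal_sup [set x | exists d' (Th : measurableType d')
      (p : {mfun Th >-> pprobability T R}) (rho : probability Th R),
    range (p : Th -> probability T R) = F /\
    x = \int[rho]_t chi2 (p t) (prior_mean p rho)].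

(* The unit 0 of the maximum gives empty parts diameter 0; it is harmless for
   the others, [renyi_half P P] being 0. *)
Definition partition_diameter (k : nat) F : \bar R :=
  ereal_inf [set x | exists G : 'I_k -> set (probability T R),
    [/\ \bigcup_i G i = F, trivIset setT G &
        x = \big[maxe/0]_(i < k)
              ereal_sup [set renyi_half P Q | P in G i & Q in G i]]].

Definition partition_diameter_sum F : \bar R :=
  match chi2_capacity F with
  | c%:E => \sum_(1 <= k < (Num.truncn c).+2) partition_diameter k F
  | _ => \sum_(1 <= k <oo) partition_diameter k F
  end.

End class_quantities.

Definition log_plus (R : realType) (x : \bar R) : \bar R :=
  lne (maxe x (expR 1)%:E).

(* Main.v *)
Require Import Defs.
From HB Require Import structures.
From mathcomp Require Import all_boot all_order all_fingroup all_algebra.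
From mathcomp Require Import all_classical all_reals all_analysis.
From mathcomp Require Import measurable_realfun spectral complex.
From mathcomp Require Import zify ring lra.

(** Let [P_1, ..., P_N] belong to the class, let [nu] be their mean, and let
    [f_i] be the density of [P_i] with respect to [nu], chosen so that
    [f_1 + ... + f_N = N] everywhere.  The overlap matrix
    [A i j = N^-1 * \int f_i f_j d nu] is symmetric, positive semidefinite and
    stochastic, and squaring the density of the permutation mixture gives
    [1 + chi2 = N^N / N! * Perm A] (lemma [chi2_permanent]).  Write
    [lam_0 >= lam_1 >= ...] for the eigenvalues of [A]; they lie in [[0, 1]].

    The permanent is bounded by the spectrum:
    [N^N / N! * Perm A <= \prod_(k >= 1) (1 - lam_k)^-1]
    (lemma [spectral_permanent_bound]).  The reason is that
    [Perm A = E \prod_i |z_i|^2] for a complex Gaussian vector [z] with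
    covariance [A], that the inequality between the arithmetic and the geometric
    mean bounds this by [N^-N * E (\sum_i |z_i|^2)^N], and that the last
    expectation is [N!] times the complete homogeneous symmetric function
    [h_N(lam_0, ..., lam_(N-1))], which is at most [\prod_(k >= 1) (1 - lam_k)^-1]
    because [lam_0 <= 1].  The proof below carries this out without Gaussian
    integrals.  The quantity [E \prod_a |z_(w a)|^2] is the permanent of the
    matrix [A (w a) (w b)] for a word [w]; the inequality
    [2 |z_i|^2 |z_j|^2 <= |z_i|^4 + |z_j|^4] becomes an inequality between such
    permanents (lemma [permanent_pair]), and repeating it shows that sampling
    the letters of [w] without replacement gives less than sampling them
    with replacement (lemma [without_le_with_replacement]).

    Two estimates control the eigenvalues.  First, a partition of the class into
    [k] parts of diameter at most [v] gives [1 - lam_k >= exp (- v)].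
    The form [|x|^2 - x^T A x] is an average of variances of [x] under the
    posterior weights [f_i / N]; a variance is at least the mean of its
    conditional variances given the part, and by Cauchy-Schwarz inside each
    part this is at least [exp (- v) * |x|^2] as soon as [x] sums to zero over
    every part, which is a subspace of codimension [k]
    (lemmas [block_overlap_form_le] and [eigenvalue_le_diameter]).  Hence
    [- ln (1 - lam_k)] is at most the partition diameter of order [k].
    Secondly, the capacity [c] bounds the trace: [\sum_k lam_k <= c + 1], by the
    uniform prior on [P_1, ..., P_N] (lemma [chi2_capacity_ge]), so that
    [lam_k <= (c + 1) / (k + 1)].

    The first estimate is used for [k <= floor c + 1] and produces the sum of
    the partition diameters.  The second one is used for larger [k], where the
    factors [(1 - lam_k)^-1] multiply to at most [exp (5 (c + 1))]
    (lemma [eigenvalue_product_bound]).  Since [log_plus] is at least 1, this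
    proves the theorem with the constant 5. *)

Set Implicit Arguments.
Unset Strict Implicit.
Unset Printing Implicit Defensive.
Import Order.TTheory GRing.Theory Num.Theory.
Import numFieldNormedType.Exports.

(** * Permanents indexed by words *)

Section Pform.
Local Open Scope ring_scope.
Variables (R : comPzRingType) (I : Type) (A : I -> I -> R).

(** The permanent of the matrix [A (w a) (v b)].  Words are functions on
    ['I_m], so that letters may be repeated and positions can be permuted by
    composition. *)
Definition permanent m (w v : 'I_m -> I) : R :=
  \sum_(s : 'S_m) \prod_(a < m) A (w a) (v (s a)).

Definition wcons m (c : I) (p : 'I_m -> I) : 'I_m.+1 -> I :=
  fun k => if unlift ord0 k is Some a then p a else c.

Lemma wcons0 m c (p : 'I_m -> I) : wcons c p ord0 = c.
Proof. by rewrite /wcons unlift_none. Qed.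

Lemma wconsS m c (p : 'I_m -> I) a : wcons c p (lift ord0 a) = p a.
Proof. by rewrite /wcons liftK. Qed.

Lemma eq_permanent m (w w' v v' : 'I_m -> I) :
  w =1 w' -> v =1 v' -> permanent w v = permanent w' v'.
Proof.
move=> ew ev; apply: eq_bigr => s _; apply: eq_bigr => a _.
by rewrite ew ev.
Qed.

Lemma permanent_permr m (w v : 'I_m -> I) (t : 'S_m) :
  permanent w (v \o t) = permanent w v.
Proof.
rewrite /permanent [RHS](reindex_inj (mulIg t)) /=.
by apply: eq_bigr => s _; apply: eq_bigr => a _; rewrite permM.
Qed.

Lemma permanent_permB m (w v : 'I_m -> I) (t : 'S_m) :
  permanent (w \o t) (v \o t) = permanent w v.
Proof.
rewrite permanent_permr /permanent.
rewrite (reindex_inj (mulgI t)) /=.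
apply: eq_bigr => s _; rewrite [RHS](reindex_inj (@perm_inj _ t)) /=.
by apply: eq_bigr => a _; rewrite permM.
Qed.

Lemma permanent_laplace m c (w : 'I_m -> I) (v : 'I_m.+1 -> I) :
  permanent (wcons c w) v =
  \sum_b A c (v b) * permanent w (v \o lift b).
Proof.
rewrite /permanent (partition_big (fun s : 'S_m.+1 => s ord0) xpredT) //=.
apply: eq_bigr => b _; rewrite big_distrr /=.
have inj_lift : injective (lift_perm ord0 b : 'S_m -> 'S_m.+1).
  move=> s s' /permP e; apply/permP => k; apply: (@lift_inj _ b).
  by have := e (lift ord0 k); rewrite !lift_perm_lift.
have surj_lift (s : 'S_m.+1) : s ord0 = b -> exists t : 'S_m, s = lift_perm ord0 b t.
  move=> s0; have s_neq k : b != s (lift ord0 k).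
    by rewrite -s0 (inj_eq perm_inj) neq_lift.
  pose h k := odflt k (unlift b (s (lift ord0 k))).
  have hE k : lift b (h k) = s (lift ord0 k).
    by rewrite /h; have [j -> ->] := unlift_some (s_neq k).
  have inj_h : injective h.
    by move=> k k' /(congr1 (lift b)); rewrite !hE => /perm_inj/lift_inj.
  exists (perm inj_h); apply/permP => k; case: (unliftP ord0 k) => [k'|] ->.
    by rewrite lift_perm_lift permE hE.
  by rewrite lift_perm_id.
rewrite (eq_bigl (mem (lift_perm ord0 b @: [set: 'S_m]))); last first.
  move=> s /=; apply/eqP/imsetP => [/surj_lift[t ->]|[t _ ->]].
    by exists t; rewrite ?inE.
  by rewrite lift_perm_id.
rewrite big_imset /=; last by move=> s s' _ _; exact: inj_lift.
under eq_bigl do rewrite inE.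
apply: eq_bigr => s _; rewrite big_ord_recl lift_perm_id wcons0; congr (_ * _).
by apply: eq_bigr => a _; rewrite lift_perm_lift wconsS.
Qed.

Hypothesis symA : forall i j, A i j = A j i.

Lemma permanentC m (w v : 'I_m -> I) : permanent w v = permanent v w.
Proof.
rewrite /permanent [RHS](reindex_inj invg_inj) /=.
apply: eq_bigr => s _; rewrite [RHS](reindex_inj (@perm_inj _ s)) /=.
by apply: eq_bigr => a _; rewrite permK symA.
Qed.

Lemma permanent_swap m i j (w : 'I_m.+2 -> I) (p : 'I_m -> I) :
  permanent w (wcons i (wcons j p)) = permanent w (wcons j (wcons i p)).
Proof.
rewrite -(permanent_permr _ _ (tperm ord0 (lift ord0 ord0))).
apply: eq_permanent => // k /=; case: tpermP => [->|->|k0 k1].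
- by rewrite !(wcons0, wconsS).
- by rewrite !(wcons0, wconsS).
- case: (unliftP ord0 k) k0 k1 => [k'|] -> // _ k1; rewrite !wconsS.
  by case: (unliftP ord0 k') k1 => [k''|] -> // _; rewrite !wconsS.
Qed.

Lemma wcons_lift m c (p : 'I_m.+1 -> I) (b : 'I_m.+1) :
  forall k : 'I_m.+1, (wcons c p \o lift (lift ord0 b)) k = wcons c (p \o lift b) k.
Proof.
move=> k /=; case: (unliftP ord0 k) => [k'|] ->.
  rewrite wconsS /= (_ : lift _ (lift _ _) = lift ord0 (lift b k')) ?wconsS //.
  by apply: val_inj; rewrite /= /bump /= add1n ltnS addnCA.
have e : lift (lift ord0 b) (ord0 : 'I_m.+1) = ord0 by exact: val_inj.
by rewrite wcons0 /= e wcons0.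
Qed.

Lemma wcons_lift0 m c (p : 'I_m -> I) : wcons c p \o lift ord0 =1 p.
Proof. by move=> k /=; rewrite wconsS. Qed.

(** Let [M_c] prepend the letter [c] to words and let [D_c] be its adjoint for
    the form [permanent A]; then [D_d M_c = M_c D_d + A d c].  The double sum is
    the inner product of [D_d M_d p] and [D_c M_c p], expanded by
    [permanent_laplace], and the last term comes from the commutator. *)
Lemma permanent_wick m c d (p : 'I_m -> I) :
  permanent (wcons d (wcons c p)) (wcons d (wcons c p)) =
  \sum_a \sum_b A d (wcons d p a) * A c (wcons c p b) *
     permanent (wcons d p \o lift a) (wcons c p \o lift b)
  + A d c * permanent (wcons c p) (wcons d p).
Proof.
have inner a : \sum_b A d (wcons d p a) * A c (wcons c p b) *
     permanent (wcons d p \o lift a) (wcons c p \o lift b) =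
  A d (wcons d p a) * permanent (wcons c (wcons d p \o lift a)) (wcons c p).
  rewrite permanent_laplace big_distrr /=.
  by apply: eq_bigr => b _; rewrite mulrA.
under eq_bigr do rewrite inner.
rewrite permanent_laplace big_ord_recl big_ord_recl wcons0 !wconsS wcons0.
rewrite [in RHS]big_ord_recl wcons0 -addrA; congr (_ * _ + _).
  rewrite [RHS]permanentC; apply: eq_permanent => //= k.
  rewrite wcons_lift0.
  by case: (unliftP ord0 k) => [k'|] ->; rewrite ?wconsS ?wcons0 ?wcons_lift0.
rewrite addrC; congr (_ + _).
  congr (_ * _); apply: eq_permanent => // k.
  by rewrite wcons_lift; case: (unliftP ord0 k) => [k'|] ->; rewrite ?wconsS ?wcons0 ?wcons_lift0.
apply: eq_bigr => a _; rewrite !wconsS; congr (_ * _).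
case: m p a {inner} => [p []//|m p a].
rewrite [RHS]permanentC.
rewrite (eq_permanent (fun=> erefl) (wcons_lift d (wcons c p) (lift ord0 a))).
pose q := wcons d (wcons c (p \o lift a)).
transitivity (permanent (wcons c p) q).
  apply: eq_permanent => // k; rewrite /q.
  by case: (unliftP ord0 k) => [k'|] ->; rewrite ?wconsS ?wcons0 // wcons_lift.
rewrite /q permanent_swap; apply: eq_permanent => // k.
by case: (unliftP ord0 k) => [k'|] ->; rewrite ?wconsS ?wcons0 // wcons_lift.
Qed.

End Pform.

(** * Positivity of permanents of Gram matrices *)

Section Psd.
Local Open Scope ring_scope.
Variables (R : realFieldType) (I : Type) (K : finType) (B : I -> K -> R).
Let A i j := \sum_k B i k * B j k.

(** The symmetric tensor, up to normalization, of the vectors [B (w a)]. *)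
Definition sym_tensor m (w : 'I_m -> I) (k : {ffun 'I_m -> K}) : R :=
  \sum_(s : 'S_m) \prod_a B (w a) (k (s a)).

(** For a Gram matrix, permanents are inner products of symmetric tensors;
    one of the two sums over permutations only contributes the factorial. *)
Lemma sum_sym_tensor m (w v : 'I_m -> I) :
  \sum_k sym_tensor w k * sym_tensor v k = m`!%:R * permanent A w v.
Proof.
transitivity (\sum_(s : 'S_m) permanent A w v); last first.
  by rewrite sumr_const card_Sn mulr_natl.
under eq_bigr do rewrite /sym_tensor big_distrl /=.
rewrite exchange_big /=; apply: eq_bigr => s _.
under eq_bigr do rewrite big_distrr /=.
rewrite exchange_big /= [RHS](reindex_inj invg_inj) /=.
rewrite (reindex_inj (mulIg s)) /=; apply: eq_bigr => t _.
transitivity (\prod_a \sum_k B (w a) k * B (v ((t^-1)%g a)) k); last by [].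
rewrite bigA_distr_bigA /=.
rewrite [RHS](reindex (fun k : {ffun 'I_m -> K} => [ffun a => k (s a)])) /=; last first.
  exists (fun k : {ffun 'I_m -> K} => [ffun a => k ((s^-1)%g a)]) => k _;
  by apply/ffunP=> a; rewrite !ffunE ?permKV ?permK.
apply: eq_bigr => k _; rewrite big_split /=; congr (_ * _).
  by apply: eq_bigr => a _; rewrite ffunE.
rewrite [RHS](reindex_inj (@perm_inj _ t)) /=.
by apply: eq_bigr => a _; rewrite ffunE permK permM.
Qed.

Lemma permanent_psd m (J : finType) (c : J -> R) (w : J -> 'I_m -> I) :
  0 <= \sum_t \sum_u c t * c u * permanent A (w t) (w u).
Proof.
rewrite -(pmulr_rge0 _ (_ : 0 < m`!%:R)); last by rewrite ltr0n fact_gt0.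
have -> : m`!%:R * (\sum_t \sum_u c t * c u * permanent A (w t) (w u)) =
    \sum_k (\sum_t c t * sym_tensor (w t) k) ^+ 2.
  rewrite big_distrr /=.
  under [RHS]eq_bigr do rewrite expr2 big_distrl /=.
  rewrite [RHS]exchange_big /=; apply: eq_bigr => t _.
  under [RHS]eq_bigr do rewrite big_distrr /=.
  rewrite [RHS]exchange_big /= big_distrr /=; apply: eq_bigr => u _.
  rewrite mulrCA -sum_sym_tensor big_distrr /=.
  by apply: eq_bigr => k _; ring.
by apply: sumr_ge0 => k _; exact: sqr_ge0.
Qed.

Let symA i j : A i j = A j i.
Proof. by apply: eq_bigr => k _; rewrite mulrC. Qed.

(** This is the positivity of [E u^2 |p|^2] for the real form
    [u = \sum_t c t * |z_(e t)|^2], where [p] is a product of coordinates of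
    the Gaussian vector.  By [permanent_wick] it splits into the square norm of
    a combination of words and a positive semidefinite commutator term. *)
Lemma permanent_pair_psd (c : bool -> R) (e : bool -> I) m (p : 'I_m -> I) :
  0 <= \sum_t \sum_u c t * c u *
    permanent A (wcons (e t) (wcons (e u) p)) (wcons (e t) (wcons (e u) p)).
Proof.
under eq_bigr do under eq_bigr do rewrite permanent_wick // mulrDr.
under eq_bigr do rewrite big_split /=.
rewrite big_split /= addr_ge0 //.
  rewrite [leRHS](_ : _ = \sum_t \sum_a \sum_u \sum_b
    (c t * A (e t) (wcons (e t) p a)) * (c u * A (e u) (wcons (e u) p b)) *
    permanent A (wcons (e t) p \o lift a) (wcons (e u) p \o lift b)); last first.
    apply: eq_bigr => t _.
    rewrite exchange_big /=; apply: eq_bigr => u _; rewrite big_distrr /=.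
    apply: eq_bigr => a _; rewrite big_distrr /=.
    by apply: eq_bigr => b _; ring.
  rewrite pair_bigA /=; under eq_bigr do rewrite pair_bigA /=.
  exact: (permanent_psd
   (fun x : bool * 'I_m.+1 => c x.1 * A (e x.1) (wcons (e x.1) p x.2))
   (fun x : bool * 'I_m.+1 => wcons (e x.1) p \o lift x.2)).
have -> : \sum_t \sum_u c t * c u *
    (A (e t) (e u) * permanent A (wcons (e u) p) (wcons (e t) p)) =
  \sum_k \sum_t \sum_u (c t * B (e t) k) * (c u * B (e u) k) *
     permanent A (wcons (e t) p) (wcons (e u) p).
  rewrite [RHS]exchange_big /=; apply: eq_bigr => t _.
  rewrite [RHS]exchange_big /=; apply: eq_bigr => u _.
  rewrite {1}/A big_distrl big_distrr /=; apply: eq_bigr => k _.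
  by rewrite (permanentC symA (wcons (e u) p)); ring.
apply: sumr_ge0 => k _.
exact: (permanent_psd (fun t => c t * B (e t) k) (fun t => wcons (e t) p)).
Qed.

(** The permanental form of [2 |z_i|^2 |z_j|^2 <= |z_i|^4 + |z_j|^4]: the
    preceding lemma for the form [|z_i|^2 - |z_j|^2]. *)
Lemma permanent_pair m i j (p : 'I_m -> I) (F := fun w => permanent A w w) :
  F (wcons i (wcons j p)) *+ 2 <=
  F (wcons i (wcons i p)) + F (wcons j (wcons j p)).
Proof.
have := permanent_pair_psd (fun b => (-1) ^+ b) (fun b : bool => if b then i else j) p.
rewrite !big_bool /= expr0 expr1.
have -> : permanent A (wcons j (wcons i p)) (wcons j (wcons i p)) =
          permanent A (wcons i (wcons j p)) (wcons i (wcons j p)).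
  by rewrite permanent_swap permanentC // permanent_swap.
rewrite /F; lra.
Qed.

End Psd.

(** * Sampling without replacement against sampling with replacement *)

Section WithReplacement.
Local Open Scope ring_scope.
Variables (R : realFieldType) (n : nat).
Local Notation word := {ffun 'I_n -> 'I_n}.
Implicit Types w u : word.

Definition upd w (b x : 'I_n) : word := [ffun c => if c == b then x else w c].

Variable F : word -> R.
Hypothesis symF : forall w (t : 'S_n), F [ffun a => w (t a)] = F w.
Hypothesis pairF : forall w a b, a != b ->
  F w *+ 2 <= F (upd w b (w a)) + F (upd w a (w b)).

Let below (k : nat) : {set 'I_n} := [set a : 'I_n | (a < k)%N].
(* [V k] sums over the words whose first [k] letters are distinct: it
   interpolates between all words ([k = 0]) and the permutations ([k = n]). *)
Let injw k w := dinjectiveb w (below k).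
Let V k := \sum_(w | injw k w) F w.

Let injwP k w : reflect {in below k &, injective w} (injw k w).
Proof. exact: dinjectiveP. Qed.

Let card_below k : (k <= n)%N -> #|below k| = k.
Proof.
move=> kn; rewrite -sum1dep_card -(big_ord_widen n (fun=> 1%N) kn).
by rewrite sum1_card card_ord.
Qed.

Section step.
Variable kk : 'I_n.
Let k := val kk.

Let injwS w : injw k.+1 w = injw k w && [forall a in below k, w a != w kk].
Proof.
apply/injwP/andP => [inj|[/injwP inj /forall_inP ne] a b].
  split.
    by apply/injwP => a b; rewrite !inE => ak bk; apply: inj; rewrite inE ltnW.
  apply/forall_inP => a; rewrite inE => ak; apply/eqP => /inj.
  rewrite !inE ltnS leqnn (ltnW ak) => /(_ isT isT) ekk.
  by move: ak; rewrite ekk ltnn.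
rewrite !inE !ltnS leq_eqVlt => /predU1P[/val_inj-> {a}|ak];
  rewrite leq_eqVlt => /predU1P[/val_inj-> {b}|bk] //.
- by move/esym/eqP; rewrite (negPf (ne _ _)) ?inE.
- by move/eqP; rewrite (negPf (ne _ _)) ?inE.
- by apply: inj; rewrite inE.
Qed.

Let Z a := \sum_(w | injw k w && (w kk == w a)) F w.

Let V_split : V k = V k.+1 + \sum_(a in below k) Z a.
Proof.
rewrite /V (bigID (injw k.+1)) /=; congr (_ + _).
  by apply: eq_bigl => w; rewrite injwS; case: (injw k w).
rewrite /Z (exchange_big_dep (injw k)) /=; last by move=> a w _ /andP[].
rewrite big_mkcondr /=; apply: eq_bigr => w inj.
case: ifPn => [|/negPn].
  rewrite injwS inj /= => /forall_inPn[a ak /negPn/eqP e].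
  rewrite (big_pred1 a) // => b /=; apply/andP/eqP => [[bk /eqP eb]|->].
    by apply: (injwP _ _ inj) => //; rewrite -eb.
  by rewrite ak e eqxx.
rewrite injwS inj /= => /forall_inP ne; rewrite big1 // => a /andP[ak /eqP e].
by have := ne _ ak; rewrite e eqxx.
Qed.

(* The map copying the letter of position [a] to position [k] has fibers of size
   [n - k]: position [k] held any of the letters not used before it. *)
Let fiber a : a \in below k ->
  \sum_(w | injw k.+1 w) F (upd w kk (w a)) = Z a *+ (n - k).
Proof.
move=> ak; have akk : a != kk.
  by apply: contraTneq ak => ->; rewrite inE ltnn.
have bkk b : b \in below k -> b == kk = false.
  by move=> bk; apply/negbTE; apply: contraTneq bk => ->; rewrite inE ltnn.
rewrite /Z -sumrMnl.
rewrite (partition_big (fun w => upd w kk (w a))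
           (fun u => injw k u && (u kk == u a))) /=; last first.
  move=> w; rewrite injwS => /andP[/injwP inj _]; rewrite !ffunE eqxx (negPf akk) eqxx andbT.
  by apply/injwP => b c bk ck; rewrite !ffunE !bkk //; apply: inj.
apply: eq_bigr => u /andP[/injwP inj /eqP ukk].
transitivity (\sum_(w | injw k.+1 w && (upd w kk (w a) == u)) F u).
  by apply: eq_bigr => w /andP[_ /eqP ->].
rewrite sumr_const; congr (_ *+ _).
have inj_upd : injective (upd u kk).
  by move=> x y /ffunP/(_ kk); rewrite !ffunE eqxx.
transitivity #|upd u kk @: ~: (u @: below k)|; last first.
  rewrite card_imset //; have := cardsC (u @: below k).
  rewrite card_in_imset // card_below; last exact/ltnW/ltn_ord.
  by rewrite card_ord => e; rewrite -[X in (X - k)%N]e addKn.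
apply: eq_card => w; rewrite -topredE /=.
apply/andP/imsetP => [[]|[x]].
  rewrite injwS => /andP[/injwP injw' /forall_inP ne] /eqP uE.
  have wu b : b \in below k -> u b = w b by move=> bk; rewrite -uE ffunE bkk.
  exists (w kk); last first.
    by apply/ffunP => b; rewrite -uE !ffunE; case: eqP => // ->.
  rewrite inE; apply/imsetP => -[b bk]; rewrite wu // => /esym/eqP.
  by rewrite (negPf (ne _ bk)).
rewrite inE => xu ->; split; last first.
  by apply/eqP/ffunP => b; rewrite !ffunE (negPf akk); case: eqP => // ->.
rewrite injwS; apply/andP; split.
  by apply/injwP => b c bk ck; rewrite !ffunE !bkk //; apply: inj.
apply/forall_inP => b bk; rewrite !ffunE eqxx bkk //.
by apply: contraNneq xu => <-; apply: imset_f.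
Qed.

(* The same count, after exchanging the positions [a] and [k]. *)
Let fiber_swap a : a \in below k ->
  \sum_(w | injw k.+1 w) F (upd w a (w kk)) = Z a *+ (n - k).
Proof.
move=> ak; rewrite -fiber //.
pose t := tperm a kk.
rewrite (reindex (fun w => [ffun b => w (t b)])) /=; last first.
  by exists (fun w => [ffun b => w (t b)]) => w _; apply/ffunP => b;
     rewrite !ffunE tpermK.
apply: eq_big => [w|w _].
  have tb b : (t b \in below k.+1) = (b \in below k.+1).
    have ak1 : (a <= k)%N by move: ak; rewrite inE => /ltnW.
    by rewrite /t; case: tpermP => [->|->|//]; rewrite !inE !ltnS ak1 leqnn.
  apply/injwP/injwP => inj b c bk ck.
    move=> e; apply: (@perm_inj _ t); apply: inj; rewrite ?tb // !ffunE.
    by rewrite !tpermK.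
  by rewrite !ffunE => /inj; rewrite !tb => /(_ bk ck); exact: perm_inj.
rewrite ffunE tpermR; congr F; apply/ffunP => b; rewrite !ffunE /t.
case: tpermP => [->|->|/eqP ba /eqP bk].
- by rewrite eqxx; case: eqP.
- by rewrite eqxx; case: eqP => // <-.
- by rewrite (negPf ba) (negPf bk).
Qed.

(** A word with [k] distinct initial letters either has [k + 1] of them, or
    repeats at position [k] the letter of some position [a < k].  The pair
    inequality, applied to the positions [a] and [k], compares the words of the
    first kind with those of the second kind. *)
Lemma distinct_prefix_step : n%:R * V k.+1 <= (n - k)%:R * V k.
Proof.
have le_Z a : a \in below k -> V k.+1 <= (n - k)%:R * Z a.
  move=> ak; have akk : kk != a.
    by apply: contraTneq ak => <-; rewrite inE ltnn.
  rewrite -[leLHS]mulr1 -(ler_pM2l (_ : 0 < 2)) //.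
  rewrite mulr1 [leRHS]mulrA -[leRHS]mulrA mulr_natl.
  rewrite [X in _ <= X](_ : _ = \sum_(w | injw k.+1 w)
     (F (upd w a (w kk)) + F (upd w kk (w a)))); last first.
    rewrite big_split /= fiber // fiber_swap // -[Z a *+ _]mulr_natl.
    by move: (_ * Z a) => X; lra.
  rewrite /V -sumrMnl; apply: ler_sum => w _; exact: pairF.
have : k%:R * V k.+1 <= (n - k)%:R * (V k - V k.+1).
  have cb : #|below k| = k by exact/card_below/ltnW/ltn_ord.
  have -> : k%:R * V k.+1 = \sum_(a in below k) V k.+1.
    by rewrite sumr_const cb mulr_natl.
  rewrite V_split addrAC subrr add0r big_distrr /=; exact: ler_sum.
have kn : (k <= n)%N by exact/ltnW/ltn_ord.
rewrite natrB // => h; nra.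
Qed.

End step.

(** The arithmetic-geometric mean inequality for a symmetric function of words
    that satisfies it on every pair of positions. *)
Lemma without_le_with_replacement :
  n%:R ^+ n * F [ffun a => a] <= \sum_w F w.
Proof.
have main k : (k <= n)%N ->
    n%:R ^+ k * V k <= (\prod_(i < k) (n - i)%:R) * \sum_w F w.
  elim: k => [_|k IH kn].
    rewrite expr0 big_ord0 !mul1r le_eqVlt; apply/orP; left; apply/eqP.
    by apply: eq_bigl => w; apply/injwP => a b; rewrite inE.
  have := distinct_prefix_step (Ordinal kn) => /= h.
  rewrite exprSr -mulrA (le_trans (ler_wpM2l _ h)) ?exprn_ge0 //.
  rewrite mulrCA big_ord_recr /= mulrAC [leRHS]mulrC.
  by rewrite ler_wpM2l // IH // ltnW.
have := main n (leqnn _).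
have -> : \prod_(i < n) (n - i)%:R = n`!%:R :> R.
  by rewrite -natr_prod -ffact_prod ffactnn.
have -> : V n = n`!%:R * F [ffun a => a].
  rewrite /V.
  transitivity (\sum_(s : 'S_n) F [ffun a => [ffun a => a] (s a)]).
    rewrite (reindex_onto (fun s : 'S_n => pval s) 
      (fun w => insubd (1%g : 'S_n) w)) /=; last first.
      move=> w /injwP inj; apply: (insubdK (1%g : 'S_n)).
      by apply/injectiveP => a b; apply: inj; rewrite inE.
    apply: eq_big => [s|s _].
      rewrite valKd eqxx andbT; apply/injwP => a b _ _.
      by rewrite !pvalE; exact: perm_inj.
    by congr F; apply/ffunP => a; rewrite !ffunE pvalE.
  by rewrite (eq_bigr (fun=> F [ffun a => a])) // sumr_const card_Sn mulr_natl.
by rewrite mulrCA ler_pM2l // ltr0n fact_gt0.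
Qed.

End WithReplacement.

(** * Permanents and complete homogeneous symmetric functions *)

Section SymmetricFunctions.
Local Open Scope ring_scope.

Lemma perm_move2 m (a b : 'I_m.+2) : a != b ->
  exists t : 'S_m.+2, t ord0 = a /\ t (lift ord0 ord0) = b.
Proof.
move=> ab; pose t1 := tperm ord0 a; pose c := t1 (lift ord0 ord0).
have ca : c != a.
  by rewrite -[X in _ != X](tpermL ord0 a) (inj_eq perm_inj).
exists (t1 * tperm c b)%g; rewrite !permM tpermL -/c tpermL; split=> //.
by rewrite tpermD // eq_sym.
Qed.

Lemma permanent_le_mean (R : realFieldType) n (K : finType)
    (B : 'I_n -> K -> R) (A := fun i j => \sum_k B i k * B j k) :
  n%:R ^+ n * permanent A id id <=
  \sum_(w : {ffun 'I_n -> 'I_n}) permanent A w w.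
Proof.
pose F (w : {ffun 'I_n -> 'I_n}) := permanent A w w.
have symF (w : {ffun 'I_n -> 'I_n}) (t : 'S_n) : F [ffun a => w (t a)] = F w.
  rewrite /F -[RHS](permanent_permB _ _ _ t).
  by apply: eq_permanent => a; rewrite ffunE.
have -> : permanent A id id = F [ffun a => a].
  by apply: eq_permanent => a; rewrite ffunE.
apply: without_le_with_replacement => // w a b.
case: n B @A @F symF w a b => [|[|m]] B A F symF w a b.
- by case: a.
- by rewrite !ord1 eqxx.
(* [t] brings the positions [a] and [b] to the front. *)
move=> ab; have [t [t0 t1]] := perm_move2 ab.
pose p := fun c => w (t (lift ord0 (lift ord0 c))).
have tb c : t (lift ord0 (lift ord0 c)) != b.
  by rewrite -t1 (inj_eq perm_inj).
have ta c : t (lift ord0 (lift ord0 c)) != a.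
  by rewrite -t0 (inj_eq perm_inj).
have FE (v : {ffun 'I_m.+2 -> 'I_m.+2}) :
    (forall c, v (t (lift ord0 (lift ord0 c))) = p c) ->
    F v = permanent A (wcons (v a) (wcons (v b) p)) (wcons (v a) (wcons (v b) p)).
  move=> vp; rewrite -(symF _ t) /F; have e c : [ffun a0 => v (t a0)] c =
      wcons (v a) (wcons (v b) p) c.
    rewrite ffunE; case: (unliftP ord0 c) => [c'|] ->; last by rewrite wcons0 t0.
    rewrite wconsS; case: (unliftP ord0 c') => [c''|] ->; last by rewrite wcons0 t1.
    by rewrite wconsS vp.
  exact: eq_permanent.
rewrite (FE (upd w b (w a))); last by move=> c; rewrite ffunE (negPf (tb c)).
rewrite (FE (upd w a (w b))); last by move=> c; rewrite ffunE (negPf (ta c)).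
rewrite (FE w) // !ffunE eqxx (negPf ab) [b == a]eq_sym (negPf ab) eqxx.
exact: permanent_pair.
Qed.

Definition delta (R : pzRingType) (K : eqType) (k l : K) : R := (k == l)%:R.

(** The permanents of all words of length [m] add up to [m!] times the trace of the
    [m]-th symmetric power, hence depends on [A] only up to conjugation; here it
    is computed in a basis of eigenvectors. *)
Lemma sum_permanent_diag (R : comNzRingType) (I K : finType) (U : I -> K -> R)
    (W : K -> I -> R) (l : K -> R) m
    (A := fun i j => \sum_k U i k * l k * W k j) :
  (forall k k', \sum_i W k i * U i k' = (k == k')%:R) ->
  \sum_(w : {ffun 'I_m -> I}) permanent A w w =
  \sum_(k : {ffun 'I_m -> K}) (\prod_a l (k a)) * permanent (delta R (K:=K)) k k.
Proof.
move=> WU; rewrite exchange_big /=.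
under [RHS]eq_bigr do rewrite big_distrr /=.
rewrite [RHS]exchange_big /=; apply: eq_bigr => s _.
under eq_bigr do rewrite bigA_distr_bigA /=.
rewrite exchange_big /=; apply: eq_bigr => k _.
transitivity (\sum_(w : {ffun 'I_m -> I}) (\prod_a l (k a)) *
    \prod_a (W (k ((s^-1)%g a)) (w a) * U (w a) (k a))).
  apply: eq_bigr => w _.
  rewrite !big_split /= [X in X * _]mulrC -mulrA; congr (_ * _).
  rewrite mulrC; congr (_ * _).
  rewrite [RHS](reindex_inj (@perm_inj _ s)) /=.
  by apply: eq_bigr => a _; rewrite permK.
rewrite -big_distrr /= -(bigA_distr_bigA (fun a i => W (k ((s^-1)%g a)) i * U i (k a))).
congr (_ * _); rewrite (reindex_inj (@perm_inj _ s)) /=.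
by apply: eq_bigr => a _; rewrite permK WU.
Qed.

Section Multiplicity.
Variables (R : realFieldType) (K : finType) (m : nat).
Local Notation word := {ffun 'I_m -> K}.
Local Notation mult := {ffun K -> 'I_m.+1}.

Definition mult_of (k : word) : mult := [ffun x => inord #|[pred a | k a == x]|].

Lemma mult_ofE k x : mult_of k x = #|[pred a | k a == x]| :> nat.
Proof.
by rewrite ffunE inordK // ltnS (leq_trans (max_card _)) // card_ord.
Qed.

Lemma eq_mult_of k k' : mult_of k = mult_of k' -> exists t : 'S_m, k' =1 k \o t.
Proof.
move=> e; have : perm_eq [tuple k' a | a < m] [tuple k a | a < m].
  apply/allP => x _ /=; rewrite !count_map /=.
  have := congr1 (fun al : mult => al x : nat) e; rewrite !mult_ofE.
  by rewrite !cardE !size_filter => e'; apply/eqP; exact: esym.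
move/tuple_permP => [t et]; exists t => a.
by have /(congr1 (fun u => tnth u a)) := val_inj et; rewrite !tnth_mktuple.
Qed.

(** The words with given multiplicities are the rearrangements of one of them,
    [k0]; replacing one of the two arguments by [k0] does not change the
    permanent, and the sum over all words of the permanents against [k0] counts
    permutations. *)
Lemma sum_mult_le (al : mult) :
  \sum_(k | mult_of k == al) permanent (delta R (K:=K)) k k <= m`!%:R.
Proof.
have pf_ge0 k k' : 0 <= permanent (delta R (K:=K)) k k' :> R.
  by move=> *; apply: sumr_ge0 => s _; apply: prodr_ge0 => a _; rewrite ler0n.
case: (pickP [pred k | mult_of k == al]) => [k0 /= /eqP k0al|none]; last first.
  by rewrite big_pred0 // ler0n.
apply: (@le_trans _ _ (\sum_(k : word) permanent (delta R (K:=K)) k k0)).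
  rewrite [leRHS](bigID (fun k => mult_of k == al)) /= -[leLHS]addr0 lerD //.
    rewrite le_eqVlt; apply/orP; left; apply/eqP.
    apply: eq_bigr => k /eqP kal.
    have [t kt] := eq_mult_of (etrans kal (esym k0al)).
    by rewrite (eq_permanent _ (fun=> erefl (k _)) kt) permanent_permr.
  exact: sumr_ge0.
rewrite exchange_big /= (eq_bigr (fun=> 1)) ?sumr_const ?card_Sn // => s _.
rewrite -(bigA_distr_bigA (fun a k => delta R k (k0 (s a)))) /=.
rewrite big1 // => a _; rewrite (bigD1 (k0 (s a))) //= /delta eqxx big1 ?addr0 //.
by move=> k /negPf ->.
Qed.

(** The right-hand side is [m!] times the complete homogeneous symmetric
    function of degree [m]. *)
Lemma sum_words_le (l : K -> R) : (forall k, 0 <= l k) ->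
  \sum_(k : word) (\prod_a l (k a)) * permanent (delta R (K:=K)) k k <=
  m`!%:R * \sum_(al : mult | (\sum_x al x == m)%N) \prod_x l x ^+ al x.
Proof.
move=> l0.
have lE (k : word) : \prod_a l (k a) = \prod_x l x ^+ mult_of k x.
  rewrite (partition_big k xpredT) //=; apply: eq_bigr => x _.
  rewrite (eq_bigr (fun=> l x)) => [|a /eqP -> //].
  by rewrite prodr_const mult_ofE.
rewrite (partition_big mult_of (fun al : mult => (\sum_x al x == m)%N)) /=; last first.
  move=> k _; apply/eqP; rewrite -[RHS](card_ord m) -sum1_card.
  rewrite [RHS](partition_big k xpredT) //=; apply: eq_bigr => x _.
  by rewrite mult_ofE -sum1_card.
rewrite big_distrr /=; apply: ler_sum => al _.
rewrite (eq_bigr (fun k : word => (\prod_x l x ^+ al x) *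
    permanent (delta R (K:=K)) k k)); last first.
  by move=> k /eqP <-; rewrite lE.
rewrite -big_distrr /= mulrC ler_wpM2r ?sum_mult_le //.
by apply: prodr_ge0 => x _; exact: exprn_ge0.
Qed.

End Multiplicity.

Lemma geom_le (R : realFieldType) (x : R) m : 0 <= x < 1 ->
  \sum_(j < m) x ^+ j <= (1 - x)^-1.
Proof.
move=> /andP[x0 x1]; rewrite -[leRHS]mul1r ler_pdivlMr ?subr_gt0 //.
have -> : (\sum_(j < m) x ^+ j) * (1 - x) = 1 - x ^+ m.
  by rewrite -opprB mulrN mulrC -subrX1 opprB.
by rewrite lerBlDr lerDl exprn_ge0.
Qed.

(** The multiplicity of index 0 is determined by the other ones and the degree;
    dropping its factor, which is at most 1, leaves a product of truncated
    geometric series. *)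
Lemma sum_mult_geom (R : realFieldType) N m (l : 'I_N.+1 -> R) :
  (forall k, 0 <= l k) -> l ord0 <= 1 -> (forall i : 'I_N, l (lift ord0 i) < 1) ->
  \sum_(al : {ffun 'I_N.+1 -> 'I_m.+1} | (\sum_x al x == m)%N) \prod_x l x ^+ al x
   <= \prod_(i < N) (1 - l (lift ord0 i))^-1.
Proof.
move=> l0 l1 ll.
(* Forgetting the multiplicity of index 0. *)
pose h (al : {ffun 'I_N.+1 -> 'I_m.+1}) : {ffun 'I_N -> 'I_m.+1} :=
  [ffun i => al (lift ord0 i)].
pose G (be : {ffun 'I_N -> 'I_m.+1}) := \prod_i l (lift ord0 i) ^+ be i.
have G0 be : 0 <= G be by apply: prodr_ge0 => i _; exact: exprn_ge0.
pose D := [set al : {ffun 'I_N.+1 -> 'I_m.+1} | (\sum_x al x == m)%N].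
have hinj : {in D &, injective h}.
  move=> al be; rewrite !inE !big_ord_recl => /eqP sa /eqP sb /ffunP e.
  have eS i : al (lift ord0 i) = be (lift ord0 i) by have := e i; rewrite !ffunE.
  apply/ffunP => x; case: (unliftP ord0 x) => [i|] -> //.
  apply: val_inj => /=; apply/eqP.
  rewrite -(eqn_add2r (\sum_(i < N) al (lift ord0 i))) sa -{1}sb eqn_add2l.
  by apply/eqP; apply: eq_bigr => i _; rewrite eS.
apply: (@le_trans _ _ (\sum_(al in D) G (h al))).
  rewrite [leRHS](eq_bigl (fun al : {ffun 'I_N.+1 -> 'I_m.+1} => (\sum_x al x == m)%N)).
    apply: ler_sum => al _; rewrite big_ord_recl /G -[leRHS]mul1r.
    rewrite ler_pM ?exprn_ge0 ?prodr_ge0 ?exprn_ile1 // => [i _|].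
      exact: exprn_ge0.
    by rewrite le_eqVlt; apply/orP; left; apply/eqP; apply: eq_bigr => i _; rewrite ffunE.
  by move=> al; rewrite inE.
rewrite -(big_imset G hinj) /=.
apply: (@le_trans _ _ (\sum_be G be)).
  by rewrite [leRHS](bigID (mem (h @: D))) /= lerDl sumr_ge0.
rewrite /G -(bigA_distr_bigA (fun i (j : 'I_m.+1) => l (lift ord0 i) ^+ j)) /=.
apply: ler_prod => i _; rewrite sumr_ge0 /=; last by move=> *; exact: exprn_ge0.
by apply: geom_le; rewrite l0 ll.
Qed.

End SymmetricFunctions.

(** * Spectral bound on permanents *)

Section SpectralBound.
Local Open Scope ring_scope.

Section Spectral.
Variables (R : rcfType).
Local Notation C := (R[i]).

Lemma sorting_perm n (f : 'I_n -> R) :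
  exists s : 'S_n, forall i j : 'I_n, (i <= j)%N -> f (s j) <= f (s i).
Proof.
pose r := fun i j => f j <= f i.
have rtot : total r by move=> i j; exact: le_total.
have rtr : transitive r by move=> j i k h1 h2; exact: le_trans h2 h1.
pose t := [tuple of sort r (ord_tuple n)].
have /tuple_permP[s es] : perm_eq t (ord_tuple n) by rewrite perm_sort.
exists s => i j ij.
have ts k : tnth t k = s k.
  by have /(congr1 (fun u => tnth u k)) := val_inj es; rewrite tnth_mktuple tnth_ord_tuple.
rewrite -!ts; have st : sorted r t by exact: sort_sorted.
rewrite !(tnth_nth i); apply: (sorted_leq_nth rtr _ i st) => //.
- by move=> k; exact: lexx.
- by rewrite inE size_tuple.
- by rewrite inE size_tuple.
Qed.

(** The eigenvectors are the conjugated rows of the complex unitary matrix [P];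
    the statements below return to real vectors by taking real and imaginary
    parts. *)
Lemma symmetric_spectral n (A : 'I_n -> 'I_n -> R) :
  (forall i j, A i j = A j i) ->
  exists (lam : 'I_n -> R) (P : 'I_n -> 'I_n -> C),
  [/\ forall i j : 'I_n, (i <= j)%N -> lam j <= lam i,
      forall i j, (A i j)%:C%C = \sum_k conjc (P k i) * (lam k)%:C%C * P k j &
      forall k l, \sum_i P k i * conjc (P l i) = (k == l)%:R].
Proof.
move=> symA; pose M : 'M[C]_n := \matrix_(i, j) (A i j)%:C%C.
have hM : M \is hermsymmx.
  apply: realsym_hermsym.
    by apply/is_hermitianmxP; rewrite expr0 scale1r map_mx_id //;
      apply/matrixP => i j; rewrite !mxE symA.
  by apply/mxOverP => i j; rewrite mxE complex_real.
have /orthomx_spectralP eM := hermitian_normalmx hM.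
have /mxOverP dreal := hermitian_spectral_diag_real hM.
set P := spectralmx M in eM; set D := spectral_diag M in eM dreal.
have uP : P \is unitarymx by exact: spectral_unitarymx.
pose lam i := complex.Re (D 0 i).
have [s sE] := sorting_perm lam.
exists (fun i => lam (s i)), (fun i j => P (s i) j); split => // [i j|k l].
  have -> : (A i j)%:C%C = M i j by rewrite mxE.
  rewrite eM invmx_unitary // mxE (reindex_inj (@perm_inj _ s)) /=.
  apply: eq_bigr => k _; rewrite mul_mx_diag !mxE; congr (_ * _ * _).
  by rewrite /lam RRe_real // dreal.
have /unitarymxP/matrixP/(_ (s k) (s l)) := uP.
rewrite !mxE (inj_eq perm_inj) => <-.
by apply: eq_bigr => i _; rewrite !mxE.
Qed.

Let Re_sum (I : finType) (F : I -> C) :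
  complex.Re (\sum_i F i) = \sum_i complex.Re (F i).
Proof. by apply: (big_morph (@complex.Re R)) => // -[a b] [c d]. Qed.

Let Re_dot (x y : C) :
  complex.Re (conjc x * y) = complex.Re x * complex.Re y + complex.Im x * complex.Im y.
Proof. by case: x y => [a b] [c d] /=; rewrite mulNr opprK. Qed.

Let Re_scale (a : R) (x : C) : complex.Re (a%:C%C * x) = a * complex.Re x.
Proof. by case: x => [c d] /=; rewrite mul0r subr0. Qed.

Section Data.
Variables (n : nat) (A : 'I_n -> 'I_n -> R).
Variables (lam : 'I_n -> R) (P : 'I_n -> 'I_n -> C).
Hypothesis lamS : forall i j : 'I_n, (i <= j)%N -> lam j <= lam i.
Hypothesis AE : forall i j,
  (A i j)%:C%C = \sum_k conjc (P k i) * (lam k)%:C%C * P k j.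
Hypothesis PP : forall k l, \sum_i P k i * conjc (P l i) = (k == l)%:R.

Let sqn (x : C) := complex.Re x ^+ 2 + complex.Im x ^+ 2.

(* The vector with coordinates [c] in the basis of eigenvectors. *)
Let vec (c : 'I_n -> C) i := \sum_k c k * conjc (P k i).

Let coord c k : \sum_j P k j * vec c j = c k.
Proof.
under eq_bigr do rewrite big_distrr /=.
rewrite exchange_big /= (bigD1 k) //= [X in _ + X]big1 ?addr0 => [|l lk].
  under eq_bigr do rewrite mulrCA.
  by rewrite -big_distrr /= PP eqxx mulr1.
under eq_bigr do rewrite mulrCA.
by rewrite -big_distrr /= PP eq_sym (negPf lk) mulr0.
Qed.

Let rayleigh c : \sum_i \sum_j A i j *
    (complex.Re (vec c i) * complex.Re (vec c j) +
     complex.Im (vec c i) * complex.Im (vec c j)) =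
  \sum_k lam k * sqn (c k).
Proof.
have : \sum_i \sum_j (A i j)%:C%C * (conjc (vec c i) * vec c j) =
       \sum_k (lam k)%:C%C * (conjc (c k) * c k).
  under eq_bigr do under eq_bigr do rewrite AE big_distrl /=.
  under eq_bigr do rewrite exchange_big /=.
  rewrite exchange_big /=; apply: eq_bigr => k _.
  rewrite -[in RHS](coord c k) rmorph_sum /= big_distrlr big_distrr /=.
  apply: eq_bigr => i _; rewrite big_distrr /=.
  by apply: eq_bigr => j _; rewrite rmorphM /=; ring.
move/(congr1 (@complex.Re R)); rewrite !Re_sum => e.
transitivity (\sum_i complex.Re (\sum_j (A i j)%:C%C * (conjc (vec c i) * vec c j))).
  apply: eq_bigr => i _; rewrite [RHS]Re_sum; apply: eq_bigr => j _.
  by rewrite Re_scale Re_dot.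
by rewrite e; apply: eq_bigr => k _; rewrite Re_scale Re_dot /sqn !expr2.
Qed.

Let parseval c : \sum_i sqn (vec c i) = \sum_k sqn (c k).
Proof.
have : \sum_i conjc (vec c i) * vec c i = \sum_k conjc (c k) * c k.
  under eq_bigr do rewrite {1}/vec rmorph_sum big_distrl /=.
  rewrite exchange_big /=; apply: eq_bigr => k _.
  rewrite -[X in _ = _ * X](coord c k) big_distrr /=; apply: eq_bigr => i _.
  by rewrite rmorphM /= conjcK mulrA.
move/(congr1 (@complex.Re R)); rewrite !Re_sum => e.
under eq_bigr do rewrite /sqn !expr2 -Re_dot.
by rewrite e; apply: eq_bigr => k _; rewrite Re_dot /sqn !expr2.
Qed.

Let sqn_ge0 x : 0 <= sqn x. Proof. by rewrite addr_ge0 ?sqr_ge0. Qed.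

Lemma eigen_ge0 :
  (forall x : 'I_n -> R, 0 <= \sum_i \sum_j A i j * (x i * x j)) ->
  forall k, 0 <= lam k.
Proof.
move=> psd k; pose c l : C := (l == k)%:R.
have := rayleigh c; rewrite [RHS](bigD1 k) //= [X in _ = _ + X]big1 ?addr0; last first.
  by move=> l lk; rewrite /c (negPf lk) /sqn /= expr0n /= addr0 mulr0.
rewrite /c eqxx /sqn /= expr0n /= expr1n addr0 mulr1 => <-.
under eq_bigr do under eq_bigr do rewrite mulrDr.
by under eq_bigr do rewrite big_split; rewrite big_split addr_ge0.
Qed.

(** Among the combinations of the first [k + 1] eigenvectors, [k] linear
    conditions leave a nonzero one, on which the form is at least [lam k]. *)
Lemma courant_fischer (k : 'I_n) (L : 'I_k -> 'I_n -> R) (mu : R) :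
  (forall x : 'I_n -> R, (forall l, \sum_i L l i * x i = 0) ->
     \sum_i \sum_j A i j * (x i * x j) <= mu * \sum_i x i ^+ 2) ->
  lam k <= mu.
Proof.
move=> H.
have wk : (k.+1 <= n)%N by exact: ltn_ord.
(* [M] has more rows than columns, hence a nonzero left kernel: its elements
   are the coordinates of the combinations that satisfy the conditions. *)
pose M : 'M[C]_(k.+1, k) :=
  \matrix_(j, l) \sum_i (L l i)%:C%C * conjc (P (widen_ord wk j) i).
have kerM : kermx M != 0.
  by rewrite -mxrank_eq0 mxrank_ker subn_eq0 -ltnNge ltnS rank_leq_col.
have /rowV0Pn[r /sub_kermxP vM v0] := kerM.
pose c (i : 'I_n) : C := if (i < k.+1)%N then r 0 (inord i) else 0.
have cw j : c (widen_ord wk j) = r 0 j by rewrite /c /= ltn_ord inord_val.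
have c0 (i : 'I_n) : (k < i)%N -> c i = 0 by rewrite /c ltnS ltnNge => /negbTE ->.
have cons l : \sum_i (L l i)%:C%C * vec c i = 0.
  have /matrixP/(_ 0 l) := vM; rewrite !mxE; apply: etrans.
  under [LHS]eq_bigr do rewrite big_distrr /=.
  rewrite [LHS]exchange_big /= (bigID (fun i : 'I_n => (i < k.+1)%N)) /=.
  rewrite [X in _ + X]big1 ?addr0; last first.
    by move=> i; rewrite -leqNgt => ki; rewrite big1 // => i' _; rewrite c0 // mul0r mulr0.
  rewrite (big_ord_narrow wk); apply: eq_bigr => i _.
  rewrite mxE big_distrr /=; apply: eq_bigr => i' _.
  by rewrite cw mulrCA.
have [j cj] : exists j, c j != 0.
  have /rV0Pn[j rj] := v0.
  by exists (widen_ord wk j); rewrite cw.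
have cpos : 0 < \sum_k sqn (c k).
  rewrite (bigD1 j) //= ltr_pwDl ?sumr_ge0 //.
  rewrite lt_neqAle sqn_ge0 andbT eq_sym.
  apply: contra_neq cj => /eqP; rewrite paddr_eq0 ?sqr_ge0 // !sqrf_eq0.
  by case: (c j) => a b /= /andP[/eqP-> /eqP->].
have consRe l : \sum_i L l i * complex.Re (vec c i) = 0.
  have := congr1 (@complex.Re R) (cons l); rewrite Re_sum => e.
  by rewrite -[RHS]e; apply: eq_bigr => i _; rewrite Re_scale.
have consIm l : \sum_i L l i * complex.Im (vec c i) = 0.
  have := congr1 (fun z => complex.Re ((- 'i%C) * z)) (cons l).
  rewrite mulr0 big_distrr Re_sum /= => e.
  rewrite -[RHS]e; apply: eq_bigr => i _; rewrite mulrCA Re_scale.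
  by case: (vec c i) => a b /=; ring.
have := lerD (H _ consRe) (H _ consIm).
have -> : mu * (\sum_i complex.Re (vec c i) ^+ 2) + mu * (\sum_i complex.Im (vec c i) ^+ 2)
     = mu * \sum_k sqn (c k).
  by rewrite -parseval -mulrDr -big_split.
rewrite -big_split /= => le1.
have : \sum_k lam k * sqn (c k) <= mu * \sum_k sqn (c k).
  rewrite -rayleigh; apply: le_trans le1; rewrite le_eqVlt; apply/orP; left; apply/eqP.
  apply: eq_bigr => i _; rewrite -big_split /=; apply: eq_bigr => j' _.
  by rewrite mulrDr.
move=> le2; rewrite -(ler_pM2r cpos); apply: le_trans le2.
rewrite big_distrr /=; apply: ler_sum => i _.
have [ki|ik] := ltnP k i; last by rewrite ler_wpM2r ?sqn_ge0 // lamS.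
by rewrite c0 // /sqn /= expr0n /= addr0 !mulr0.
Qed.

Lemma trace_eigen : \sum_i A i i = \sum_k lam k.
Proof.
apply: complexI; rewrite !rmorph_sum /=; under eq_bigr do rewrite AE.
rewrite exchange_big /=; apply: eq_bigr => k _.
transitivity ((lam k)%:C%C * \sum_i P k i * conjc (P k i)).
  by rewrite big_distrr /=; apply: eq_bigr => i _; ring.
by rewrite PP eqxx mulr1.
Qed.

(** A real Gram decomposition is obtained from the complex eigenvectors by
    listing their real and imaginary parts separately. *)
Lemma gram_eigen : (forall k, 0 <= lam k) ->
  let B i (x : bool * 'I_n) := Num.sqrt (lam x.2) *
     (if x.1 then complex.Re (P x.2 i) else complex.Im (P x.2 i)) in
  forall i j, A i j = \sum_x B i x * B j x.
Proof.
move=> lam0 B i j; have := congr1 (@complex.Re R) (AE i j); rewrite Re_sum /= => ->.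
rewrite -(pair_bigA _ (fun b k => B i (b, k) * B j (b, k))) /=.
rewrite exchange_big /=; apply: eq_bigr => k _; rewrite big_bool /= /B /=.
rewrite mulrAC mulrC Re_scale Re_dot -{1}(sqr_sqrtr (lam0 k)); ring.
Qed.

Lemma sum_permanent_eigen :
  \sum_(w : {ffun 'I_n -> 'I_n}) permanent A w w =
  \sum_(k : {ffun 'I_n -> 'I_n}) (\prod_a lam (k a)) *
     permanent (delta R (K := 'I_n)) k k.
Proof.
apply: complexI; rewrite !rmorph_sum /=.
pose AC i j := \sum_k conjc (P k i) * (lam k)%:C%C * P k j.
transitivity (\sum_(w : {ffun 'I_n -> 'I_n}) permanent AC w w).
  apply: eq_bigr => w _; rewrite rmorph_sum; apply: eq_bigr => s _.
  by rewrite rmorph_prod; apply: eq_bigr => a _; rewrite /= AE.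
rewrite (@sum_permanent_diag C _ _ (fun i k => conjc (P k i)) P
  (fun k => (lam k)%:C%C)) //; apply: eq_bigr => k _.
rewrite rmorphM rmorph_prod rmorph_sum; congr (_ * _); apply: eq_bigr => s _.
by rewrite rmorph_prod; apply: eq_bigr => a _; rewrite /delta rmorph_nat.
Qed.

End Data.
End Spectral.

(** The Gram decomposition feeds the comparison with sampling with
    replacement, whose right-hand side is then evaluated on the spectrum. *)
Theorem spectral_permanent_bound (R : rcfType) N (A : 'I_N.+1 -> 'I_N.+1 -> R) :
  (forall i j, A i j = A j i) ->
  (forall x : 'I_N.+1 -> R, 0 <= \sum_i \sum_j A i j * (x i * x j)) ->
  exists lam : 'I_N.+1 -> R,
  [/\ forall k, 0 <= lam k,
      forall i j : 'I_N.+1, (i <= j)%N -> lam j <= lam i,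
      \sum_k lam k = \sum_i A i i,
      forall (k : 'I_N.+1) (L : 'I_k -> 'I_N.+1 -> R) (mu : R),
        (forall x : 'I_N.+1 -> R, (forall l, \sum_i L l i * x i = 0) ->
           \sum_i \sum_j A i j * (x i * x j) <= mu * \sum_i x i ^+ 2) ->
        lam k <= mu &
      lam ord0 <= 1 -> (forall i : 'I_N, lam (lift ord0 i) < 1) ->
        N.+1%:R ^+ N.+1 * permanent A id id <=
        N.+1`!%:R * \prod_(i < N) (1 - lam (lift ord0 i))^-1].
Proof.
move=> symA psdA; have [lam [P [lamS AE PP]]] := symmetric_spectral symA.
have lam0 := eigen_ge0 AE PP psdA.
exists lam; split => //; first by rewrite (trace_eigen AE PP).
  exact: courant_fischer AE PP.
move=> l1 ll; pose B i (x : bool * 'I_N.+1) := Num.sqrt (lam x.2) *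
     (if x.1 then complex.Re (P x.2 i) else complex.Im (P x.2 i)).
have AB : A =2 (fun i j => \sum_x B i x * B j x) by exact: gram_eigen.
have pE m (w : 'I_m -> 'I_N.+1) :
    permanent A w w = permanent (fun i j => \sum_x B i x * B j x) w w.
  by apply: eq_bigr => s _; apply: eq_bigr => a _; rewrite AB.
rewrite pE; apply: (le_trans (permanent_le_mean B)).
under eq_bigr do rewrite -pE.
rewrite (sum_permanent_eigen AE PP); apply: (le_trans (sum_words_le _ lam0)).
by rewrite ler_wpM2l ?ler0n //; exact: sum_mult_geom.
Qed.

End SpectralBound.

(** * The product over the eigenvalues *)

Section EigenvalueProduct.
Local Open Scope ring_scope.

Section Numeric.
Variable R : realType.

(** The product is the binomial coefficient of [2 q + 1] over [q]. *)
Lemma prod_bin_le q : \prod_(j < q) ((q + j + 2)%:R / j.+1%:R) <= 2 ^+ (q.*2.+1) :> R.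
Proof.
have -> : \prod_(j < q) ((q + j + 2)%:R / j.+1%:R) = 'C(q.*2.+1, q)%:R :> R.
  rewrite prodf_div -!natr_prod.
  have -> : (\prod_(j < q) j.+1 = q`!)%N by rewrite fact_prod big_add1 big_mkord.
  have -> : (\prod_(j < q) (q + j + 2) = q.*2.+1 ^_ q)%N.
    rewrite ffact_prod [RHS](reindex_inj rev_ord_inj) /=.
    by apply: eq_bigr => j _; have := ltn_ord j; lia.
  by rewrite -bin_ffact natrM mulfK // pnatr_eq0 -lt0n fact_gt0.
rewrite -natrX ler_nat -[2%N]/(1 + 1)%N expnDn.
have qlt : (q < q.*2.+2)%N by lia.
rewrite (bigD1 (Ordinal qlt)) //= !exp1n !muln1 leq_addr //.
Qed.

Lemma inv_1sub_le_exp (x : R) : 0 <= x <= 2^-1 -> (1 - x)^-1 <= expR (2 * x).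
Proof.
move=> /andP[x0 x1]; have p : 0 < 1 - x by lra.
rewrite -[leLHS]mul1r ler_pdivrMr //.
apply: (@le_trans _ _ ((1 + 2 * x) * (1 - x))); first nra.
by rewrite ler_wpM2r ?expR_ge1Dx // ltW.
Qed.

Lemma antitone_le_sum N (lam : 'I_N -> R) (k : 'I_N) :
  (forall j, 0 <= lam j) -> (forall i j : 'I_N, (i <= j)%N -> lam j <= lam i) ->
  k.+1%:R * lam k <= \sum_j lam j.
Proof.
move=> lam0 lamS; rewrite (bigID (fun j : 'I_N => (j < k.+1)%N)) /=.
rewrite -[leLHS]addr0 lerD ?sumr_ge0 // (big_ord_narrow (ltn_ord k)).
rewrite -[X in X%:R * _]card_ord mulr_natl -sumr_const.
by apply: ler_sum => j _; apply: lamS; rewrite -ltnS; exact: (ltn_ord j).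
Qed.

(** Indices below [m + 2] are covered by [d].  For the others
    [lam_k <= (c + 1) / (k + 1)]: up to [2 m + 2] this gives
    [(1 - lam_k)^-1 <= (k + 1) / (k - m - 1)], whose product is a binomial
    coefficient, and beyond it gives [lam_k <= 1/2], so that
    [(1 - lam_k)^-1 <= exp (2 lam_k)] and the trace takes over. *)
Lemma eigenvalue_product_bound N m (c : R) (lam : 'I_N.+1 -> R) (d : nat -> R) :
  m%:R <= c -> c < m.+1%:R ->
  (forall k, 0 <= lam k <= 1) ->
  (forall i j : 'I_N.+1, (i <= j)%N -> lam j <= lam i) ->
  \sum_k lam k <= c + 1 ->
  (forall k, 0 <= d k) ->
  (forall k : 'I_N.+1, (0 < k < m.+2)%N -> (1 - lam k)^-1 <= expR (d k)) ->
  \prod_(i < N) (1 - lam (lift ord0 i))^-1 <=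
    expR (\sum_(1 <= k < m.+2) d k + 5 * (c + 1)).
Proof.
move=> mc cm lam01 lamS tr d0 dle.
have c0 : 0 <= c by apply: le_trans mc; rewrite ler0n.
have lam0 k : 0 <= lam k by case/andP: (lam01 k).
(* Extending the eigenvalues by 0 adds trivial factors, so that the product can
   always be split at [m + 2] and at [2 m + 3]. *)
pose l k := if (k < N.+1)%N then lam (inord k) else 0.
have l0 k : 0 <= l k by rewrite /l; case: ifP.
have lE (k : 'I_N.+1) : l k = lam k by rewrite /l ltn_ord inord_val.
have sl k : \sum_(0 <= i < k) l i <= c + 1.
  apply: le_trans tr; under [leRHS]eq_bigr do rewrite -lE.
  rewrite -(big_mkord xpredT l) -[leLHS]addr0.
  have [kN|Nk] := leqP k N.+1.
    by rewrite [leRHS](big_cat_nat (n := k)) //= lerD2l sumr_ge0.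
  rewrite (big_cat_nat (n := N.+1)) //=; last exact: ltnW.
  rewrite addr0 gerDl le_eqVlt big_nat big1 ?eqxx // => i /andP[Ni _].
  by rewrite /l ltnNge Ni.
have kl k : k.+1%:R * l k <= c + 1.
  rewrite {1}/l; case: ifPn => [kN|_]; last by rewrite mulr0; lra.
  by rewrite -[in X in X%:R * _](inordK kN) (le_trans (antitone_le_sum _ lam0 lamS)).
pose M := maxn N.+1 (m.*2 + 3).
have -> : \prod_(i < N) (1 - lam (lift ord0 i))^-1 = \prod_(1 <= k < M) (1 - l k)^-1.
  rewrite (big_cat_nat (n := N.+1)) ?leq_maxl //= [X in _ * X]big_nat.
  rewrite [X in _ * X]big1 ?mulr1.
    rewrite big_add1 big_mkord; apply: eq_bigr => i _.
    by rewrite -lE.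
  by move=> i /andP[Ni _]; rewrite /l ltnNge Ni subr0 invr1.
have ge0 k : 0 <= (1 - l k)^-1.
  rewrite invr_ge0 subr_ge0 /l; case: ifP => // _.
  by case/andP: (lam01 (inord k)).
rewrite (big_cat_nat (n := m.+2)) //=; last by rewrite /M; lia.
rewrite (big_cat_nat (n := m.*2 + 3) (m := m.+2)) //=; [|by lia|by rewrite leq_maxr].
have -> : expR (\sum_(1 <= k < m.+2) d k + 5 * (c + 1)) =
   expR (\sum_(1 <= k < m.+2) d k) * (expR (3 * (c + 1)) * expR (2 * (c + 1))).
  by rewrite -!expRD; congr expR; ring.
have pge a b : 0 <= \prod_(a <= k < b) (1 - l k)^-1 by apply: prodr_ge0.
apply: ler_pM => //; first by rewrite mulr_ge0.
  rewrite expR_sum !big_nat; apply: ler_prod => k /andP[k1 k2].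
  rewrite ge0 /= /l; case: ifPn => kN; last by rewrite subr0 invr1 -expR0 ler_expR.
  by rewrite -[in leRHS](inordK kN) dle // inordK // k1.
apply: ler_pM => //.
  apply: (@le_trans _ _ (2 ^+ (m.+1.*2.+1))).
    apply: le_trans (prod_bin_le m.+1).
    have -> : (m.*2 + 3 = m.+1 + m.+2)%N by lia.
    rewrite -{1}[m.+2]add0n big_addn addnK big_mkord; apply: ler_prod => j _.
    rewrite ge0 /=.
    have lj : (j + m.+2)%N.+1%:R * l (j + m.+2)%N <= c + 1 by exact: kl.
    have -> : (m.+1 + j + 2 = (j + m.+2).+1)%N by lia.
    have K0 : 0 < (j + m.+2)%N.+1%:R :> R by rewrite ltr0n.
    have J0 : 0 < j.+1%:R :> R by rewrite ltr0n.
    have e : (j + m.+2)%N.+1%:R = j.+1%:R + m.+1%:R + 1 :> R.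
      by rewrite -natrD natr1 addSn addnS [in RHS]addnS -addSn ?addSn ?addnS.
    rewrite -[leRHS]invf_div lef_pV2 ?posrE ?divr_gt0 //.
      by rewrite ler_pdivrMr // mulrBl mul1r mulrC; move: lj; rewrite e; lra.
    apply: lt_le_trans (_ : j.+1%:R / (j + m.+2)%N.+1%:R <= _); first exact: divr_gt0.
    by rewrite ler_pdivrMr // mulrBl mul1r mulrC; move: lj; rewrite e; lra.
  apply: (@le_trans _ _ (expR 1 ^+ m.+1.*2.+1)).
    by rewrite lerXn2r ?nnegrE ?expR_ge0 //; apply: le_trans (expR_ge1Dx _); lra.
  rewrite -expRM_natl ler_expR mulr1 -addnn -addSn natrD -!natr1.
  by rewrite -natr1 in cm; lra.
apply: (@le_trans _ _ (\prod_(m.*2 + 3 <= k < M) expR (2 * l k))).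
  rewrite !big_nat; apply: ler_prod => k /andP[k1 k2].
  rewrite ge0 inv_1sub_le_exp // l0 /=.
  have := kl k; have kc : 2 * (m%:R + 2) <= k.+1%:R :> R.
    by rewrite -natrD -natrM ler_nat; lia.
  rewrite -natr1 in cm; have := l0 k; nra.
rewrite -expR_sum ler_expR -big_distrr /= ler_pM2l // (le_trans _ (sl M)) //.
rewrite [leRHS](big_cat_nat (n := m.*2 + 3)) //=; last by rewrite leq_maxr.
by rewrite lerDr sumr_ge0.
Qed.

End Numeric.

End EigenvalueProduct.

(** * Densities and the chi-square divergence *)

Section Density.
Local Open Scope classical_set_scope.
Local Open Scope ring_scope.
Local Open Scope charge_scope.
Local Open Scope ereal_scope.
Context d (T : measurableType d) (R : realType).
Implicit Types P Q : probability T R.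

(** A density is required to be real valued and nonnegative everywhere, while a
    Radon-Nikodym derivative has these properties only almost everywhere. *)
Definition has_density P Q (f : T -> R) :=
  [/\ measurable_fun setT f, (forall x, 0 <= f x)%R &
      forall A, measurable A -> P A = \int[Q]_(x in A) (f x)%:E].

Lemma has_density_dominates P Q f : has_density P Q f -> P `<< Q.
Proof.
move=> [mf f0 PE] A nA; move=> B mB BA.
have QB : Q B = 0 by apply: nA.
rewrite PE //; apply: null_set_integral => //.
by apply/measurable_funTS/measurable_EFinP.
Qed.

Lemma has_density_ae P Q f : has_density P Q f ->
  ae_eq Q setT ('d (charge_of_finite_measure P) '/d Q) (EFin \o f).
Proof.
move=> hd; have PQ := has_density_dominates hd; have [mf f0 PE] := hd.
apply: integral_ae_eq => //.
- exact: Radon_Nikodym_integrable.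
- exact/measurable_EFinP.
- by move=> A _ mA; rewrite -Radon_Nikodym_integral //= PE.
Qed.

Lemma integral_density P Q f (g : T -> \bar R) : has_density P Q f ->
  measurable_fun setT g -> (forall x, 0 <= g x) ->
  \int[P]_x g x = \int[Q]_x (g x * (f x)%:E).
Proof.
move=> hd mg g0; have PQ := has_density_dominates hd; have [mf f0 PE] := hd.
rewrite -(Radon_Nikodym_SigmaFinite.change_of_variables PQ) //.
have mS : measurable_fun setT (Radon_Nikodym_SigmaFinite.f P Q).
  exact: measurable_int (Radon_Nikodym_SigmaFinite.f_integrable PQ).
apply: ge0_ae_eq_integral => //.
- exact: emeasurable_funM.
- by apply: emeasurable_funM => //; exact/measurable_EFinP.
- by move=> x _; rewrite mule_ge0 // Radon_Nikodym_SigmaFinite.f_ge0.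
- by move=> x _; rewrite mule_ge0 // lee_fin.
have ae1 := ae_eq_Radon_Nikodym_SigmaFinite PQ measurableT.
have ae2 := has_density_ae hd.
apply: filterS2 ae1 ae2 => x /= e1 e2 _.
by rewrite e1 // e2.
Qed.

Lemma density_total P Q f : has_density P Q f -> \int[Q]_x (f x)%:E = 1.
Proof. by move=> [_ _ PE]; rewrite -PE // probability_setT. Qed.

(** Expanding [(f - 1)^2] would involve a difference of integrals that may be
    infinite; the proof integrates [f^2 + 1 = (f - 1)^2 + 2 f] instead. *)
Lemma chi2_density P Q f : has_density P Q f ->
  1 + chi2 P Q = \int[Q]_x (f x ^+ 2)%:E.
Proof.
move=> hd; have PQ := has_density_dominates hd; have [mf f0 PE] := hd.
have mEf : measurable_fun setT (EFin \o f) by exact/measurable_EFinP.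
have mf2 : measurable_fun setT (fun x => (f x ^+ 2)%:E).
  by apply/measurable_EFinP; exact: measurable_funX.
have mf1 : measurable_fun setT (fun x => ((f x - 1) ^+ 2)%:E).
  by apply/measurable_EFinP; apply: measurable_funX; exact: measurable_funB.
rewrite /chi2 asboolT //.
have -> : \int[Q]_x ('d (charge_of_finite_measure P) '/d Q x - 1) ^+ 2 =
          \int[Q]_x ((f x - 1) ^+ 2)%:E.
  apply: ae_eq_integral => //.
    have mD : measurable_fun setT ('d (charge_of_finite_measure P) '/d Q).
      by apply: measurable_int; exact: Radon_Nikodym_integrable.
    have mDB : measurable_fun setT
        (fun x => 'd (charge_of_finite_measure P) '/d Q x - 1).
      exact: emeasurable_funB.
    rewrite (_ : (fun x => _ ^+ 2) = (fun x =>
     ('d (charge_of_finite_measure P) '/d Q x - 1) * ('d (charge_of_finite_measure P) '/d Q x - 1))).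
      exact: emeasurable_funM.
    by apply/funext => x; rewrite expe2.
  by have := has_density_ae hd; apply: filterS => x /= -> // _; rewrite -EFinB -EFin_expe.
have key : \int[Q]_x (f x ^+ 2)%:E + 1 = \int[Q]_x ((f x - 1) ^+ 2)%:E + 2%:E.
  transitivity (\int[Q]_x ((f x ^+ 2)%:E + 1)).
    rewrite ge0_integralD //; last by move=> x _; rewrite lee_fin sqr_ge0.
    congr (_ + _); transitivity (1 * Q setT); last exact/esym/integral_cst.
    by rewrite probability_setT mule1.
  transitivity (\int[Q]_x (((f x - 1) ^+ 2)%:E + ((f x)%:E + (f x)%:E))).
    by apply: eq_integral => x _; rewrite -!EFinD; congr EFin; ring.
  rewrite ge0_integralD //; last 3 first.
  - by move=> x _; rewrite lee_fin sqr_ge0.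
  - by move=> x _; rewrite -EFinD lee_fin addr_ge0.
  - exact: emeasurable_funD.
  rewrite ge0_integralD //; [|by move=> x _; rewrite lee_fin..].
  by rewrite (density_total hd) -EFinD.
have : 0 <= \int[Q]_x (f x ^+ 2)%:E.
  by apply: integral_ge0 => x _; rewrite lee_fin sqr_ge0.
have : 0 <= \int[Q]_x ((f x - 1) ^+ 2)%:E.
  by apply: integral_ge0 => x _; rewrite lee_fin sqr_ge0.
move: key; move: (\int[Q]_x _) => a; move: (\int[Q]_x _) => b.
case: a => [a| |] //; case: b => [b| |] //=; rewrite -?EFinD; try by [].
by move=> [e] _ _; congr EFin; lra.
Qed.

End Density.

(** * Densities of tensor products and of mixtures *)

Section Tensor.
Local Open Scope classical_set_scope.
Local Open Scope ring_scope.
Local Open Scope charge_scope.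
Local Open Scope ereal_scope.
Context d (T : measurableType d) (R : realType).
Implicit Types P Q : probability T R.

Lemma integral_tensorS n (P : 'I_n.+1 -> probability T R)
    (G : n.+1.-tuple T -> \bar R) :
  measurable_fun setT G -> (forall t, 0 <= G t) ->
  \int[tensor P]_t G t =
  \int[P ord0]_x \int[tensor (fun i => P (lift ord0 i))]_t G (tuple_cons (x, t)).
Proof.
move=> mG G0.
have mc : measurable_fun setT (@tuple_cons _ T n) by exact: measurable_cons.
have G0' : {in [set: n.+1.-tuple T], forall t, 0 <= G t} by move=> t _; exact: G0.
rewrite [LHS](ge0_integral_pushforward mc _ measurableT mG G0').
rewrite preimage_setT; apply: fubini_tonelli1 => //.
- exact: measurableT_comp.
- by move=> z; exact: G0.
Qed.

Lemma measurable_tuple_cons_section n (G : n.+1.-tuple T -> \bar R) x :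
  measurable_fun setT G ->
  measurable_fun setT (fun t => G (tuple_cons (x, t))).
Proof.
move=> mG; apply: (measurableT_comp mG).
have mc : measurable_fun setT (@tuple_cons _ T n) by exact: measurable_cons.
apply: (measurableT_comp mc); exact: measurable_fun_pair.
Qed.

Lemma measurable_tuple_cons_integral n (G : n.+1.-tuple T -> \bar R)
    (mu : probability (n.-tuple T) R) :
  measurable_fun setT G -> (forall t, 0 <= G t) ->
  measurable_fun setT (fun x => \int[mu]_t G (tuple_cons (x, t))).
Proof.
move=> mG G0; apply: (measurable_fun_fubini_tonelli_F (m2 := mu)
  (fun z => G (tuple_cons z))) => //.
by apply: (measurableT_comp mG); exact: measurable_cons.
Qed.

Lemma measurable_prod_tnth n (f : 'I_n -> T -> R) :
  (forall i, measurable_fun setT (f i)) ->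
  measurable_fun setT (fun t : n.-tuple T => \prod_(i < n) f i (tnth t i))%R.
Proof.
move=> mf; apply: measurable_prod => i _.
by apply: measurableT_comp => //; exact: measurable_tnth.
Qed.

Lemma prod_tuple_cons n (f : 'I_n.+1 -> T -> R) x (t : n.-tuple T) :
  (\prod_(i < n.+1) f i (tnth (tuple_cons (x, t)) i) =
   f ord0 x * \prod_(i < n) f (lift ord0 i) (tnth t i))%R.
Proof.
by rewrite big_ord_recl; congr (_ * _)%R; apply: eq_bigr => i _; rewrite tnthS.
Qed.

(** Changing the measure in one coordinate at a time, by Tonelli. *)
Lemma integral_tensor_density n (P Q : 'I_n -> probability T R) (f : 'I_n -> T -> R)
    (G : n.-tuple T -> \bar R) :
  (forall i, has_density (P i) (Q i) (f i)) ->
  measurable_fun setT G -> (forall t, 0 <= G t) ->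
  \int[tensor P]_t G t =
  \int[tensor Q]_t (G t * (\prod_(i < n) f i (tnth t i))%:E).
Proof.
elim: n P Q f G => [|n IH] P Q f G hd mG G0.
  by apply: eq_integral => t _; rewrite big_ord0 mule1.
have mf i : measurable_fun setT (f i) by case: (hd i).
have f0 i x : (0 <= f i x)%R by case: (hd i).
rewrite integral_tensorS // integral_tensorS; first last.
- by move=> t; rewrite mule_ge0 // lee_fin prodr_ge0.
- by apply: emeasurable_funM => //; apply/measurable_EFinP; exact: measurable_prod_tnth.
rewrite (integral_density (hd ord0)); first last.
- by move=> x; exact: integral_ge0.
- exact: measurable_tuple_cons_integral.
apply: eq_integral => x _.
rewrite (IH _ (fun i => Q (lift ord0 i)) (fun i => f (lift ord0 i))) //; last first.
  exact: measurable_tuple_cons_section.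
rewrite -ge0_integralZr //; first last.
- by rewrite lee_fin.
- by move=> t _; rewrite mule_ge0 // lee_fin prodr_ge0.
- apply: emeasurable_funM; first exact: measurable_tuple_cons_section.
  by apply/measurable_EFinP; exact: (measurable_prod_tnth (fun i => mf (lift ord0 i))).
apply: eq_integral => t _; rewrite prod_tuple_cons -muleA -EFinM.
by rewrite mulrC.
Qed.

Lemma tensor_density n (P Q : 'I_n -> probability T R) (f : 'I_n -> T -> R) :
  (forall i, has_density (P i) (Q i) (f i)) ->
  has_density (tensor P) (tensor Q) (fun t => \prod_(i < n) f i (tnth t i))%R.
Proof.
move=> hd.
have mf i : measurable_fun setT (f i) by case: (hd i).
have f0 i x : (0 <= f i x)%R by case: (hd i).
split => [|t|A mA]; [exact: measurable_prod_tnth|exact: prodr_ge0|].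
transitivity (\int[tensor P]_t (\1_A t)%:E).
  by rewrite integral_indic // setIT.
rewrite [RHS]integral_mkcond (integral_tensor_density hd); first last.
- by move=> t; rewrite lee_fin.
- by apply/measurable_EFinP; exact: measurable_indic.
apply: eq_integral => t _; rewrite /patch indicE.
by case: ifP => _; rewrite ?mul1e ?mul0e.
Qed.

Lemma integral_tensor_prod n (Q : 'I_n -> probability T R) (f : 'I_n -> T -> R) :
  (forall i, measurable_fun setT (f i)) -> (forall i x, 0 <= f i x)%R ->
  \int[tensor Q]_t (\prod_(i < n) f i (tnth t i))%:E =
  \prod_(i < n) \int[Q i]_x (f i x)%:E.
Proof.
elim: n Q f => [|n IH] Q f mf f0.
  under eq_integral do rewrite big_ord0.
  rewrite big_ord0; transitivity (1 * tensor Q setT); first exact: integral_cst.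
  by rewrite probability_setT mule1.
rewrite integral_tensorS; first last.
- by move=> t; rewrite lee_fin prodr_ge0.
- by apply/measurable_EFinP; exact: measurable_prod_tnth.
rewrite big_ord_recl -(IH (fun i => Q (lift ord0 i)) (fun i => f (lift ord0 i))) //.
rewrite -ge0_integralZr //; first last.
- by apply: integral_ge0 => t _; rewrite lee_fin prodr_ge0.
- by move=> x _; rewrite lee_fin.
- exact/measurable_EFinP.
apply: eq_integral => x _.
rewrite -ge0_integralZl //; first last.
- by rewrite lee_fin.
- by move=> t _; rewrite lee_fin prodr_ge0.
- by apply/measurable_EFinP; exact: (measurable_prod_tnth (fun i => mf (lift ord0 i))).
by apply: eq_integral => t _; rewrite prod_tuple_cons EFinM.
Qed.

End Tensor.

Section Mixture.
Local Open Scope classical_set_scope.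
Local Open Scope ring_scope.
Local Open Scope ereal_scope.
Context d (T : measurableType d) (R : realType).

Lemma uniform_mixture_density (I : finType) (i0 : I) (P : I -> probability T R)
    (Q : probability T R) (f : I -> T -> R) :
  (forall i, has_density (P i) Q (f i)) ->
  has_density (uniform_mixture i0 P) Q (fun x => #|I|%:R^-1 * \sum_i f i x)%R.
Proof.
move=> hd.
have mf i : measurable_fun setT (f i) by case: (hd i).
have f0 i x : (0 <= f i x)%R by case: (hd i).
split => [|x|A mA].
- by apply: measurable_funM => //; exact: measurable_sum.
- by rewrite mulr_ge0 ?invr_ge0 ?ler0n // sumr_ge0.
rewrite /= /uniform_mixture.
under eq_integral do rewrite EFinM -sumEFin.
rewrite ge0_integralZl //; first last.
- by move=> x _; apply: sume_ge0 => i _; rewrite lee_fin.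
- by apply: emeasurable_sum => i; apply/measurable_EFinP/measurable_funTS.
congr (_ * _); rewrite ge0_integral_sum //.
- by apply: eq_bigr => i _; case: (hd i) => _ _ ->.
- by move=> i; apply/measurable_EFinP/measurable_funTS.
- by move=> i x _; rewrite lee_fin.
Qed.

Lemma integral_uniform_mixture n (P : 'I_n.+1 -> probability T R) (g : T -> \bar R) :
  measurable_fun setT g -> (forall x, 0 <= g x) ->
  \int[uniform_mixture ord0 P]_x g x =
  (n.+1%:R^-1)%:E * \sum_i \int[P i]_x g x.
Proof.
move=> mg g0.
have c0 : (0 <= n.+1%:R^-1 :> R)%R by rewrite invr_ge0.
rewrite (@eq_measure_integral _ _ _ setT
   (mscale (NngNum c0) (msum (fun k => P (inord k)) n.+1))); last first.
  move=> A mA _; rewrite /= /uniform_mixture /mscale /msum /= card_ord; congr (_ * _).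
  by apply: eq_bigr => i _; rewrite inord_val.
rewrite ge0_integral_mscale // ge0_integral_measure_sum //; congr (_ * _).
by apply: eq_bigr => i _; rewrite inord_val.
Qed.

End Mixture.

(** * Densities of the components of a mixture; bounded functions *)

Section MixtureDensities.
Local Open Scope classical_set_scope.
Local Open Scope ring_scope.
Local Open Scope charge_scope.
Local Open Scope ereal_scope.
Context d (T : measurableType d) (R : realType).

Lemma eq_ae_density (P Q : probability T R) (f g : T -> R) :
  has_density P Q f -> measurable_fun setT g -> (forall x, 0 <= g x)%R ->
  ae_eq Q setT (EFin \o f) (EFin \o g) -> has_density P Q g.
Proof.
move=> [mf f0 PE] mg g0 fg; split=> // A mA; rewrite PE //.
apply: ge0_ae_eq_integral => //.
- exact/measurable_EFinP/measurable_funTS.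
- exact/measurable_EFinP/measurable_funTS.
- by move=> x _; rewrite lee_fin.
- by move=> x _; rewrite lee_fin.
by apply: filterS fg => x /= e _; exact: e.
Qed.

Variables (n : nat) (P : 'I_n.+1 -> probability T R).
Let nu : probability T R := uniform_mixture ord0 P.

Lemma component_dominates i : P i `<< nu.
Proof.
move=> A nA B mB BA; have : nu B = 0 by exact: nA.
rewrite /nu /= /uniform_mixture => /eqP; rewrite mule_eq0 eqe invr_eq0 pnatr_eq0 card_ord /=.
rewrite (bigD1 i) //= padde_eq0 ?sume_ge0 //.
by move=> /andP[/eqP].
Qed.

(** The Radon-Nikodym derivatives sum to the number of components only almost
    everywhere; on the exceptional set they are all replaced by 1. *)
Lemma mixture_densities : exists f : 'I_n.+1 -> T -> R,
  (forall i, has_density (P i) nu (f i)) /\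
  (forall x, \sum_i f i x = n.+1%:R)%R.
Proof.
pose g i x := fine (Radon_Nikodym_SigmaFinite.f (P i) nu x).
have gE i x : (g i x)%:E = Radon_Nikodym_SigmaFinite.f (P i) nu x.
  by rewrite /g fineK // Radon_Nikodym_SigmaFinite.f_fin_num //; exact: component_dominates.
have hg i : has_density (P i) nu (g i).
  have iS := Radon_Nikodym_SigmaFinite.f_integrable (component_dominates i).
  split => [|x|A mA].
  - apply/measurable_EFinP; rewrite (_ : _ \o _ = Radon_Nikodym_SigmaFinite.f (P i) nu).
      exact: measurable_int iS.
    by apply/funext => x; rewrite /= gE.
  - by rewrite -lee_fin gE; apply: Radon_Nikodym_SigmaFinite.f_ge0; exact: component_dominates.
  - under eq_integral do rewrite gE.
    by apply: Radon_Nikodym_SigmaFinite.f_integral => //; exact: component_dominates.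
have mg i : measurable_fun setT (g i) by case: (hg i).
have g0 i x : (0 <= g i x)%R by case: (hg i).
pose s x := (\sum_i g i x)%R.
have ms : measurable_fun setT s by exact: measurable_sum.
have s1 : ae_eq nu setT (EFin \o s) (EFin \o cst n.+1%:R%R).
  have h1 := has_density_ae (uniform_mixture_density ord0 hg).
  have h2 : has_density nu nu (cst 1%R).
    split => // A mA; transitivity (1 * nu A); first by rewrite mul1e.
    by rewrite -(integral_cst nu mA).
  have := has_density_ae h2; apply: filterS2 h1 => x /= e1 e2 _.
  have := e2 I; rewrite e1 // => -[]; rewrite card_ord => e; congr EFin.
  by rewrite -[LHS](mulVKf (_ : n.+1%:R != 0)%R) ?pnatr_eq0 // -/(s x) e mulr1.
pose f i x := if s x == n.+1%:R then g i x else 1%R.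
exists f; split => [i|x]; last first.
  rewrite /f; case: eqP => // _; rewrite sumr_const card_ord //.
apply: (eq_ae_density (hg i)).
- apply: measurable_fun_ifT => //; exact: measurable_fun_eqr.
- by move=> x; rewrite /f; case: ifP.
by apply: filterS s1 => x /= e _; rewrite /f; have [->] := e I; rewrite eqxx.
Qed.

End MixtureDensities.

Section Bounded.
Local Open Scope classical_set_scope.
Local Open Scope ring_scope.
Context d (T : measurableType d) (R : realType) (Q : probability T R).

(** All integrands in the analysis of the overlap matrix lie in this class, on
    which real-valued integration is linear and monotone. *)
Definition bounded_mfun (g : T -> R) :=
  measurable_fun setT g /\ exists M, forall x, `|g x| <= M.

Lemma bmfun_int g : bounded_mfun g -> Q.-integrable setT (EFin \o g).
Proof.
move=> [mg [M gM]]; apply: measurable_bounded_integrable => //.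
  by rewrite -ge0_fin_numE ?fin_num_measure.
exists M; split; first exact: num_real.
by move=> y My x _; exact: le_trans (gM x) (ltW My).
Qed.

Lemma bmfun_EFin g : bounded_mfun g ->
  (\int[Q]_x (g x)%:E)%E = (\int[Q]_x g x)%:E.
Proof. by move=> bg; rewrite /Rintegral fineK // integrable_fin_num //; exact: bmfun_int. Qed.

Lemma bmfun_cst c : bounded_mfun (fun _ => c).
Proof. by split; [exact: measurable_cst|exists `|c|]. Qed.

Lemma bmfunD g h : bounded_mfun g -> bounded_mfun h -> bounded_mfun (fun x => g x + h x).
Proof.
move=> [mg [M gM]] [mh [N hN]]; split; first exact: measurable_funD.
by exists (M + N) => x; rewrite (le_trans (ler_normD _ _)) // lerD.
Qed.

Lemma bmfunM g h : bounded_mfun g -> bounded_mfun h -> bounded_mfun (fun x => g x * h x).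
Proof.
move=> [mg [M gM]] [mh [N hN]]; split; first exact: measurable_funM.
by exists (M * N) => x; rewrite normrM ler_pM.
Qed.

Lemma bmfunZ c g : bounded_mfun g -> bounded_mfun (fun x => c * g x).
Proof. by move=> bg; apply: bmfunM => //; exact: bmfun_cst. Qed.

Lemma bmfun_sum (I : finType) (p : pred I) (g : I -> T -> R) :
  (forall i, bounded_mfun (g i)) -> bounded_mfun (fun x => \sum_(i | p i) g i x).
Proof.
move=> bg; elim: (index_enum I) => [|i r IH].
  rewrite (_ : (fun x => _) = (fun=> 0)); first exact: bmfun_cst.
  by apply/funext => x; rewrite big_nil.
rewrite (_ : (fun x => _) = (fun x => (if p i then g i x else 0) + \sum_(j <- r | p j) g j x)).
  by apply: bmfunD => //; case: (p i) => //; exact: bmfun_cst.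
by apply/funext => x; rewrite big_cons; case: (p i); rewrite ?add0r.
Qed.

Lemma measurable_sqrt (h : T -> R) : measurable_fun setT h ->
  measurable_fun setT (fun x => Num.sqrt (h x)).
Proof.
have ms : measurable_fun [set: R] (@Num.sqrt R).
  by apply: continuous_measurable_fun; exact: sqrt_continuous.
exact: measurableT_comp ms.
Qed.

Lemma bmfun_sqrt h : bounded_mfun h -> (forall x, 0 <= h x) ->
  bounded_mfun (fun x => Num.sqrt (h x)).
Proof.
move=> [mh [M hM]] h0; split; first exact: measurable_sqrt.
exists (Num.sqrt M) => x; rewrite ger0_norm ?sqrtr_ge0 // ler_wsqrtr //.
by apply: le_trans (hM x); exact: ler_norm.
Qed.

Lemma RintD g h : bounded_mfun g -> bounded_mfun h ->
  \int[Q]_x (g x + h x) = \int[Q]_x g x + \int[Q]_x h x.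
Proof. by move=> bg bh; apply: RintegralD => //; exact: bmfun_int. Qed.

Lemma RintZ c g : bounded_mfun g -> \int[Q]_x (c * g x) = c * \int[Q]_x g x.
Proof. by move=> bg; apply: RintegralZl => //; exact: bmfun_int. Qed.

Lemma Rint_sum (I : finType) (p : pred I) (g : I -> T -> R) :
  (forall i, bounded_mfun (g i)) ->
  \int[Q]_x (\sum_(i | p i) g i x) = \sum_(i | p i) \int[Q]_x g i x.
Proof.
move=> bg; apply: EFin_inj; rewrite -bmfun_EFin; last exact: bmfun_sum.
under eq_integral do rewrite -sumEFin.
rewrite integral_sum //=; last by move=> i; exact: bmfun_int.
by rewrite -sumEFin; apply: eq_bigr => i _; rewrite bmfun_EFin.
Qed.

Lemma le_Rint g h : bounded_mfun g -> bounded_mfun h -> (forall x, g x <= h x) ->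
  \int[Q]_x g x <= \int[Q]_x h x.
Proof. by move=> bg bh gh; apply: le_Rintegral => //; exact: bmfun_int. Qed.

Lemma Rint_cst c : \int[Q]_x c = c.
Proof.
rewrite /Rintegral (_ : (\int[Q]_x c%:E)%E = (c%:E * Q setT)%E); last exact: integral_cst.
by rewrite probability_setT mule1.
Qed.

Lemma Rint_cauchy_schwarz g h : bounded_mfun g -> bounded_mfun h ->
  (\int[Q]_x (g x * h x)) ^+ 2 <= (\int[Q]_x (g x ^+ 2)) * \int[Q]_x (h x ^+ 2).
Proof.
move=> bg bh.
have bgg : bounded_mfun (fun x => g x ^+ 2) by exact: bmfunM.
have bhh : bounded_mfun (fun x => h x ^+ 2) by exact: bmfunM.
have bgh := bmfunM bg bh.
set a := \int[Q]_x (g x ^+ 2); set b := \int[Q]_x (g x * h x); set c := \int[Q]_x (h x ^+ 2).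
(* The integral of [(s g + t h)^2]; the two values of [(s, t)] used below make
   this form negative unless the inequality holds. *)
have key s t : 0 <= s ^+ 2 * a + 2 * s * t * b + t ^+ 2 * c.
  have -> : s ^+ 2 * a + 2 * s * t * b + t ^+ 2 * c =
      \int[Q]_x (s ^+ 2 * g x ^+ 2 + 2 * s * t * (g x * h x) + t ^+ 2 * h x ^+ 2).
    rewrite RintD; [|by apply: bmfunD; exact: bmfunZ|exact: bmfunZ].
    by rewrite RintD ?RintZ //; exact: bmfunZ.
  apply: Rintegral_ge0 => x _.
  by have := sqr_ge0 (s * g x + t * h x); rewrite sqrrD; nra.
have a0 : 0 <= a by apply: Rintegral_ge0 => x _; exact: sqr_ge0.
have c0 : 0 <= c by apply: Rintegral_ge0 => x _; exact: sqr_ge0.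
have [c_0|cn] := eqVneq c 0.
  have [->|bn] := eqVneq b 0; first by rewrite expr0n /= mulr_ge0.
  have := key 1 (- (a + 1) / b); rewrite c_0 mulr0 mulr0 addr0 expr1n mul1r mulr1.
  rewrite (_ : 2 * _ * b = - 2 * (a + 1)); [lra|by field].
have cp : 0 < c by rewrite lt_neqAle eq_sym cn.
rewrite -subr_ge0 -(pmulr_rge0 _ cp).
by rewrite (_ : c * _ = c ^+ 2 * a + 2 * c * (- b) * b + (- b) ^+ 2 * c) ?key //; ring.
Qed.

End Bounded.

(** * Quadratic forms of stochastic matrices *)

Section Algebra.
Local Open Scope ring_scope.
Variables (R : realFieldType).

(** The weighted Cauchy-Schwarz inequality in a form where some weights may
    vanish. *)
Lemma sum_sqr_le_weighted (I : finType) (s g : I -> R) :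
  (forall l, 0 <= g l) -> (forall l, g l = 0 -> s l = 0) ->
  (\sum_l s l) ^+ 2 <= (\sum_l g l) * \sum_l s l ^+ 2 / g l.
Proof.
move=> g0 gs; set a := \sum_l s l; set b := \sum_l g l.
have b0 : 0 <= b by exact: sumr_ge0.
have [bz|bn] := eqVneq b 0.
  have gz l : g l = 0.
    by apply/eqP; move/eqP: bz; rewrite psumr_eq0 // => /allP/(_ l); rewrite mem_index_enum => /(_ isT).
  have az : a = 0 by rewrite /a big1 // => l _; rewrite gs.
  by rewrite bz az mul0r expr2 mul0r.
have bp : 0 < b by rewrite lt_neqAle eq_sym bn.
have : 0 <= \sum_l (s l - g l * (a / b)) ^+ 2 / g l.
  by apply: sumr_ge0 => l _; rewrite divr_ge0 ?sqr_ge0.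
have -> : \sum_l (s l - g l * (a / b)) ^+ 2 / g l =
    \sum_l (s l ^+ 2 / g l - 2 * (a / b) * s l + (a / b) ^+ 2 * g l).
  apply: eq_bigr => l _; have [gl|gl] := eqVneq (g l) 0; last by field; rewrite gl bn.
  by rewrite gl gs // invr0 !mulr0 subrr addr0.
rewrite big_split sumrB -!big_distrr /= -/a -/b.
set q := \sum_l _; have -> : q - 2 * (a / b) * a + (a / b) ^+ 2 * b = (b * q - a ^+ 2) / b.
  by field.
by rewrite pmulr_lge0 ?invr_gt0 // subr_ge0.
Qed.

Lemma stochastic_form_le n (A : 'I_n -> 'I_n -> R) (x : 'I_n -> R) :
  (forall i j, 0 <= A i j) -> (forall i j, A i j = A j i) ->
  (forall i, \sum_j A i j = 1) ->
  \sum_i \sum_j A i j * (x i * x j) <= \sum_i x i ^+ 2.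
Proof.
move=> A0 symA A1.
have -> : \sum_i x i ^+ 2 = \sum_i \sum_j A i j * ((x i ^+ 2 + x j ^+ 2) / 2).
  have e1 : \sum_i \sum_j A i j * x i ^+ 2 = \sum_i x i ^+ 2.
    by apply: eq_bigr => i _; rewrite -big_distrl /= A1 mul1r.
  have e2 : \sum_i \sum_j A i j * x j ^+ 2 = \sum_i x i ^+ 2.
    rewrite exchange_big -e1; apply: eq_bigr => i _; apply: eq_bigr => j _.
    by rewrite symA.
  transitivity ((\sum_i \sum_j A i j * x i ^+ 2 + \sum_i \sum_j A i j * x j ^+ 2) / 2).
    by rewrite e1 e2; field.
  rewrite -big_split /= big_distrl /=; apply: eq_bigr => i _.
  rewrite -big_split /= big_distrl /=; apply: eq_bigr => j _; ring.
apply: ler_sum => i _; apply: ler_sum => j _; rewrite ler_wpM2l //.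
by have := sqr_ge0 (x i - x j); rewrite sqrrB; lra.
Qed.

(** Inside a block the form is [\sum x_i^2] minus a sum of terms
    [K i j (x_i - x_j)^2], in which [K] can be replaced by its lower bound; for
    the constant matrix the double sum is explicit since [x] sums to zero over
    the block. *)
Lemma block_stochastic_form_le n (L : finType) (S : 'I_n -> L) (K : 'I_n -> 'I_n -> R)
    (x : 'I_n -> R) (e : R) :
  (forall i j, S j == S i -> K i j = K j i) ->
  (forall i, \sum_(j | S j == S i) K i j = 1) ->
  (forall i j, S j == S i -> e / #|[pred j | S j == S i]|%:R <= K i j) ->
  (forall l, \sum_(i | S i == l) x i = 0) ->
  \sum_i \sum_(j | S j == S i) K i j * (x i * x j) <= (1 - e) * \sum_i x i ^+ 2.
Proof.
move=> symK K1 Ke x0.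
pose m i : R := #|[pred j | S j == S i]|%:R.
have m0 i : m i != 0.
  by rewrite pnatr_eq0 -lt0n; apply/card_gt0P; exists i; rewrite inE /=.
have mS i j : S j == S i -> m j = m i by move=> /eqP e'; rewrite /m e'.
have exch (G : 'I_n -> 'I_n -> R) : \sum_i \sum_(j | S j == S i) G i j =
   \sum_i \sum_(j | S j == S i) G j i.
  rewrite (exchange_big_dep xpredT) //=; apply: eq_bigr => i _.
  by apply: eq_bigl => j; rewrite eq_sym.
have e1 : \sum_i \sum_(j | S j == S i) K i j * x i ^+ 2 = \sum_i x i ^+ 2.
  by apply: eq_bigr => i _; rewrite -big_distrl /= K1 mul1r.
have e2 : \sum_i \sum_(j | S j == S i) K i j * x j ^+ 2 = \sum_i x i ^+ 2.
  by rewrite exch -e1; apply: eq_bigr => i _; apply: eq_bigr => j ij; rewrite symK // eq_sym.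
have f1 : \sum_i \sum_(j | S j == S i) e / m i * x i ^+ 2 = e * \sum_i x i ^+ 2.
  rewrite big_distrr /=; apply: eq_bigr => i _.
  rewrite (eq_bigl (mem [pred j | S j == S i])) // sumr_const -mulr_natr -/(m i).
  by rewrite mulrAC divfK.
have f2 : \sum_i \sum_(j | S j == S i) e / m i * x j ^+ 2 = e * \sum_i x i ^+ 2.
  rewrite exch -f1; apply: eq_bigr => i _; apply: eq_bigr => j ij.
  by rewrite (mS _ _ ij).
have f3 : \sum_i \sum_(j | S j == S i) e / m i * (x i * x j) = 0.
  apply: big1 => i _; rewrite -!big_distrr /= x0 !mulr0 //.
have : \sum_i \sum_(j | S j == S i) (e / m i) * (x i - x j) ^+ 2 <=
       \sum_i \sum_(j | S j == S i) K i j * (x i - x j) ^+ 2.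
  apply: ler_sum => i _; apply: ler_sum => j ij.
  by rewrite ler_wpM2r ?sqr_ge0 //; exact: Ke.
have expand (G : 'I_n -> 'I_n -> R) :
   \sum_i \sum_(j | S j == S i) G i j * (x i - x j) ^+ 2 =
   \sum_i \sum_(j | S j == S i) G i j * x i ^+ 2 +
   \sum_i \sum_(j | S j == S i) G i j * x j ^+ 2
   - 2 * \sum_i \sum_(j | S j == S i) G i j * (x i * x j).
  rewrite big_distrr -sumrN -!big_split /=; apply: eq_bigr => i _.
  rewrite big_distrr -sumrN -!big_split /=; apply: eq_bigr => j _; ring.
rewrite !expand e1 e2 f1 f2 f3; lra.
Qed.

End Algebra.

(** * The overlap matrix of a mixture *)

Section Overlap.
Local Open Scope classical_set_scope.
Local Open Scope ring_scope.
Context d (T : measurableType d) (R : realType).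
Variables (n : nat) (P : 'I_n.+1 -> probability T R).
Let nu : probability T R := uniform_mixture ord0 P.
Variable f : 'I_n.+1 -> T -> R.
Hypothesis hd : forall i, has_density (P i) nu (f i).
Hypothesis fsum : forall x, \sum_i f i x = n.+1%:R.

Let f0 i x : 0 <= f i x. Proof. by case: (hd i). Qed.

Let fN i x : f i x <= n.+1%:R.
Proof. by rewrite -(fsum x) (bigD1 i) //= lerDl sumr_ge0. Qed.

Let mf i : measurable_fun setT (f i). Proof. by case: (hd i). Qed.

Let bf i : bounded_mfun (f i).
Proof. by split => //; exists n.+1%:R => x; rewrite ger0_norm. Qed.

Let bff i j : bounded_mfun (fun x => f i x * f j x). Proof. exact: bmfunM. Qed.

Lemma density_bounded i : bounded_mfun (f i). Proof. exact: bf. Qed.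

Let Rint_f i : \int[nu]_x f i x = 1.
Proof. by apply: EFin_inj; rewrite -bmfun_EFin // (density_total (hd i)). Qed.

Definition overlap i j : R := n.+1%:R^-1 * \int[nu]_x (f i x * f j x).

Let N0 : n.+1%:R != 0 :> R. Proof. by rewrite pnatr_eq0. Qed.

Lemma overlapC i j : overlap i j = overlap j i.
Proof. by rewrite /overlap; under eq_Rintegral do rewrite mulrC. Qed.

Lemma overlap_ge0 i j : 0 <= overlap i j.
Proof. by rewrite mulr_ge0 ?invr_ge0 ?ler0n // Rintegral_ge0 // => x _; exact: mulr_ge0. Qed.

Lemma overlap_sum i : \sum_j overlap i j = 1.
Proof.
rewrite -big_distrr -Rint_sum //=.
under eq_Rintegral do rewrite -big_distrr /= fsum mulrC.
by rewrite RintZ // Rint_f mulr1 mulVf.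
Qed.

Lemma overlap_trace_ge1 : 1 <= \sum_i overlap i i.
Proof.
rewrite -big_distrr /= ler_pdivlMl ?ltr0n // mulr1.
rewrite -[X in X%:R <= _](card_ord n.+1) -sumr_const; apply: ler_sum => i _.
have := Rint_cauchy_schwarz nu (bf i) (bmfun_cst T 1).
under eq_Rintegral do rewrite mulr1.
under [X in _ <= _ * X -> _]eq_Rintegral do rewrite expr1n.
by rewrite Rint_f Rint_cst expr1n mulr1.
Qed.

Lemma overlap_form (x : 'I_n.+1 -> R) :
  \sum_i \sum_j overlap i j * (x i * x j) =
  n.+1%:R^-1 * \int[nu]_t (\sum_i x i * f i t) ^+ 2.
Proof.
transitivity (n.+1%:R^-1 * \int[nu]_t (\sum_i \sum_j (x i * x j) * (f i t * f j t))).
  rewrite Rint_sum; last by move=> i; apply: bmfun_sum => j; exact: bmfunZ.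
  rewrite big_distrr /=; apply: eq_bigr => i _.
  rewrite Rint_sum; last by move=> j; exact: bmfunZ.
  rewrite big_distrr /=; apply: eq_bigr => j _.
  by rewrite RintZ // /overlap; ring.
congr (_ * _); apply: eq_Rintegral => t _.
rewrite expr2 big_distrl /=; apply: eq_bigr => i _.
by rewrite big_distrr /=; apply: eq_bigr => j _; ring.
Qed.

Lemma overlap_psd (x : 'I_n.+1 -> R) :
  0 <= \sum_i \sum_j overlap i j * (x i * x j).
Proof.
by rewrite overlap_form mulr_ge0 ?invr_ge0 // Rintegral_ge0 // => t _; exact: sqr_ge0.
Qed.

Lemma overlap_form_le (x : 'I_n.+1 -> R) :
  \sum_i \sum_j overlap i j * (x i * x j) <= \sum_i x i ^+ 2.
Proof.
by apply: stochastic_form_le; [exact: overlap_ge0|exact: overlapC|exact: overlap_sum].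
Qed.

Section block.
Variables (L : finType) (S : 'I_n.+1 -> L).
Let g l x := \sum_(i | S i == l) f i x.

Let g0 l x : 0 <= g l x. Proof. exact: sumr_ge0. Qed.

Let fg i x : f i x <= g (S i) x.
Proof. by rewrite /g (bigD1 i) //= lerDl sumr_ge0. Qed.

Let fgz i x : g (S i) x = 0 -> f i x = 0.
Proof. by move=> gz; apply/eqP; rewrite eq_le f0 andbT -gz fg. Qed.

Let bg l : bounded_mfun (g l). Proof. exact: bmfun_sum. Qed.

Let mg l : measurable_fun setT (g l). Proof. by case: (bg l). Qed.

Let measurable_Vg l : measurable_fun setT (fun x => (g l x)^-1).
Proof.
rewrite (_ : (fun x => _) = (fun y => y `^ (-1)) \o g l).
  by apply: measurableT_comp => //; exact: measurable_powR.
by apply/funext => x /=; rewrite powR_inv1.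
Qed.

(* The integrand of the block kernel: given that the component lies in the
   block of [i], the posterior weights are [f j / g (S i)].  Where [g (S i)]
   vanishes, [f i] vanishes too and the quotient is 0. *)
Let kf i j x := (S j == S i)%:R * (f i x * f j x / g (S i) x).

Let kf0 i j x : 0 <= kf i j x.
Proof. by rewrite mulr_ge0 ?ler0n // divr_ge0 // mulr_ge0. Qed.

Let bkf i j : bounded_mfun (kf i j).
Proof.
split.
  by apply: measurable_funM => //; apply: measurable_funM => //; case: (bff i j).
exists n.+1%:R => x; rewrite ger0_norm // /kf.
case: eqP => [ij|_]; rewrite ?mul0r ?ler0n // mul1r.
have [gz|gn] := eqVneq (g (S i) x) 0; first by rewrite gz invr0 mulr0.
have gp : 0 < g (S i) x by rewrite lt_neqAle eq_sym gn g0.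
by rewrite ler_pdivrMr // ler_pM // -ij.
Qed.

Let K i j := \int[nu]_x kf i j x.

Let K_sym i j : S j == S i -> K i j = K j i.
Proof.
move=> /eqP ij; rewrite /K /kf; under eq_Rintegral do rewrite ij eqxx mulrC.
by apply: eq_Rintegral => x _; rewrite ij eqxx mulrC [f i x * _]mulrC.
Qed.

Let K_sum i : \sum_(j | S j == S i) K i j = 1.
Proof.
rewrite -Rint_sum // -(Rint_f i); apply: eq_Rintegral => x _.
rewrite /kf (eq_bigr (fun j => f i x / g (S i) x * f j x)); last first.
  by move=> j ->; rewrite mul1r mulrAC.
rewrite -big_distrr /= -/(g (S i) x).
have [gz|gn] := eqVneq (g (S i) x) 0; first by rewrite (fgz gz) !mul0r.
by rewrite divfK.
Qed.

(* Cauchy-Schwarz against [g (S i)], whose integral is the size of the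
   block: the factor that makes the bound independent of how small the block
   is. *)
Let K_ge (e : R) i j : S j == S i ->
  e <= (\int[nu]_t Num.sqrt (f i t * f j t)) ^+ 2 ->
  e / #|[pred j | S j == S i]|%:R <= K i j.
Proof.
move=> ij eb; pose m : R := #|[pred j | S j == S i]|%:R.
have mp : 0 < m.
  by rewrite ltr0n; apply/card_gt0P; exists i; rewrite inE /=.
rewrite ler_pdivrMr // (le_trans eb) //.
have bu : bounded_mfun (fun t => Num.sqrt (kf i j t)) by exact: bmfun_sqrt.
have bv : bounded_mfun (fun t => Num.sqrt (g (S i) t)) by exact: bmfun_sqrt.
have -> : \int[nu]_t Num.sqrt (f i t * f j t) =
          \int[nu]_t (Num.sqrt (kf i j t) * Num.sqrt (g (S i) t)).
  apply: eq_Rintegral => t _; rewrite -sqrtrM //; congr Num.sqrt.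
  rewrite /kf ij mul1r; have [gz|gn] := eqVneq (g (S i) t) 0; last by rewrite divfK.
  by rewrite gz mulr0 (fgz gz) mul0r.
apply: le_trans (Rint_cauchy_schwarz nu bu bv) _.
rewrite le_eqVlt; apply/orP; left; apply/eqP; congr (_ * _).
  by apply: eq_Rintegral => t _; rewrite sqr_sqrtr.
transitivity (\int[nu]_t g (S i) t).
  by apply: eq_Rintegral => t _; rewrite sqr_sqrtr.
rewrite Rint_sum // (eq_bigr (fun=> 1)) //.
by rewrite (eq_bigl (mem [pred j | S j == S i])) // sumr_const.
Qed.

(** The left-hand side is the second moment of [x] under the posterior weights
    [f_i / N].  The weighted Cauchy-Schwarz inequality over the blocks bounds it
    by the block kernel: passing to conditional variances only decreases a
    variance. *)
Lemma block_overlap_form_le (x : 'I_n.+1 -> R) (e : R) :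
  (forall i j, S j == S i ->
     e <= (\int[nu]_t Num.sqrt (f i t * f j t)) ^+ 2) ->
  (forall l, \sum_(i | S i == l) x i = 0) ->
  \sum_i \sum_j overlap i j * (x i * x j) <= (1 - e) * \sum_i x i ^+ 2.
Proof.
move=> eS x0.
have := block_stochastic_form_le K_sym K_sum (fun i j ij => K_ge ij (eS i j ij)) x0.
apply: le_trans; rewrite overlap_form.
pose h t := \sum_i \sum_(j | S j == S i) (x i * x j) * kf i j t.
have bh : bounded_mfun h by apply: bmfun_sum => i; apply: bmfun_sum => j; exact: bmfunZ.
have -> : \sum_i \sum_(j | S j == S i) K i j * (x i * x j) = \int[nu]_t h t.
  rewrite Rint_sum; last by move=> i; apply: bmfun_sum => j; exact: bmfunZ.
  apply: eq_bigr => i _; rewrite Rint_sum; last by move=> j; exact: bmfunZ.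
  by apply: eq_bigr => j _; rewrite RintZ // mulrC.
rewrite ler_pdivrMl ?ltr0n // -RintZ //; apply: le_Rint.
- by apply: bmfunM; apply: bmfun_sum => i; exact: bmfunZ.
- exact: bmfunZ.
move=> t; pose s l := \sum_(i | S i == l) x i * f i t.
have -> : \sum_i x i * f i t = \sum_l s l by rewrite (partition_big S xpredT).
have <- : \sum_l g l t = n.+1%:R by rewrite -(fsum t) [RHS](partition_big S xpredT).
have gs l : g l t = 0 -> s l = 0.
  move=> gz; rewrite /s big1 // => i /eqP il.
  by rewrite (@fgz i t) ?mulr0 // il.
apply: le_trans (sum_sqr_le_weighted (fun l => g0 l t) gs) _.
rewrite le_eqVlt; apply/orP; left; apply/eqP; congr (_ * _).
rewrite /h [RHS](partition_big S xpredT) //=; apply: eq_bigr => l _.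
rewrite expr2 /s big_distrl big_distrl /=; apply: eq_bigr => i /eqP il.
rewrite big_distrr big_distrl /= il; apply: eq_bigr => j /eqP jl.
by rewrite /kf il jl eqxx mul1r; ring.
Qed.

End block.

End Overlap.

(** * The chi-square divergence of a permutation mixture as a permanent *)

Section Permanent.
Local Open Scope classical_set_scope.
Local Open Scope ring_scope.
Local Open Scope ereal_scope.
Context d (T : measurableType d) (R : realType).
Variables (n : nat) (P : 'I_n.+1 -> probability T R).
Let nu : probability T R := uniform_mixture ord0 P.
Variable f : 'I_n.+1 -> T -> R.
Hypothesis hd : forall i, has_density (P i) nu (f i).
Hypothesis bf : forall i, bounded_mfun (f i).

(** Both densities in the square are sums over permutations of products of
    the [f_i]; after integration only the relative permutation matters. *)
Lemma chi2_permanent :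
  1 + chi2 (permutation_mixture P) (mean_field P) =
  (n.+1%:R ^+ n.+1 / n.+1`!%:R * permanent (overlap P f) id id)%:E.
Proof.
have f0 i x : (0 <= f i x)%R by case: (hd i).
have mf i : measurable_fun setT (f i) by case: (hd i).
have hs := uniform_mixture_density (1%g : 'S_n.+1)
  (fun s : 'S_n.+1 => tensor_density (fun i => hd (s i))).
rewrite (chi2_density hs) card_Sn.
pose F (s u : 'S_n.+1) (t : n.+1.-tuple T) : R :=
  (\prod_(i < n.+1) (f (s i) (tnth t i) * f (u i) (tnth t i)))%R.
have F0 s u t : (0 <= F s u t)%R by apply: prodr_ge0 => i _; exact: mulr_ge0.
have mF s u : measurable_fun setT (EFin \o F s u).
  apply/measurable_EFinP; apply: (measurable_prod_tnth (f := fun i x => f (s i) x * f (u i) x)%R).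
  by move=> i; exact: measurable_funM.
have -> : \int[tensor (fun=> nu)]_t ((n.+1`!%:R^-1 *
     \sum_(s : 'S_n.+1) \prod_(i < n.+1) f (s i) (tnth t i)) ^+ 2)%R%:E =
   \int[tensor (fun=> nu)]_t ((n.+1`!%:R^-1 ^+ 2)%R%:E *
      \sum_(s : 'S_n.+1) \sum_(u : 'S_n.+1) (F s u t)%:E).
  apply: eq_integral => t _.
  have -> : \sum_(s : 'S_n.+1) \sum_(u : 'S_n.+1) (F s u t)%:E =
      (\sum_(s : 'S_n.+1) \sum_(u : 'S_n.+1) F s u t)%R%:E.
    by rewrite -sumEFin; apply: eq_bigr => s _; rewrite sumEFin.
  rewrite -EFinM exprMn; congr (_ * _)%R%:E.
  rewrite expr2 big_distrl /=; apply: eq_bigr => s _.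
  rewrite big_distrr /=; apply: eq_bigr => u _.
  by rewrite -big_split.
have Fint s u : \int[tensor (fun=> nu)]_t (F s u t)%:E =
    (\prod_(i < n.+1) (n.+1%:R * overlap P f (s i) (u i)))%:E.
  rewrite (integral_tensor_prod _ (f := fun i x => f (s i) x * f (u i) x)%R); first last.
  - by move=> i x; exact: mulr_ge0.
  - by move=> i; exact: measurable_funM.
  rewrite -prodEFin; apply: eq_bigr => i _.
  by rewrite bmfun_EFin ?mulVKf ?pnatr_eq0 //; exact: bmfunM.
have mFs s : measurable_fun setT (fun t => \sum_(u : 'S_n.+1) (F s u t)%:E).
  by apply: emeasurable_sum => u; exact: mF.
rewrite ge0_integralZl //; first last.
- by move=> t _; apply: sume_ge0 => s _; apply: sume_ge0 => u _; rewrite lee_fin.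
- by apply: emeasurable_sum => s.
rewrite ge0_integral_sum //; last first.
  by move=> s t _; apply: sume_ge0 => u _; rewrite lee_fin.
have -> : \sum_(s : 'S_n.+1) \int[tensor (fun=> nu)]_t (\sum_(u : 'S_n.+1) (F s u t)%:E) =
   (\sum_(s : 'S_n.+1) (n.+1%:R ^+ n.+1 * permanent (overlap P f) id id))%R%:E.
  rewrite -sumEFin; apply: eq_bigr => s _.
  rewrite ge0_integral_sum //; last 2 first.
  - by move=> u; exact: mF.
  - by move=> u t _; rewrite lee_fin.
  rewrite /permanent big_distrr /= -sumEFin.
  rewrite (reindex_inj (mulgI s)) /=; apply: eq_bigr => u _.
  rewrite Fint big_split /= prodr_const card_ord; congr (_ * _)%:E.
  rewrite [RHS](reindex_inj (@perm_inj _ s)) /=.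
  by apply: eq_bigr => i _; rewrite permM.
rewrite -EFinM sumr_const card_Sn -mulr_natl; congr EFin.
by field; rewrite pnatr_eq0 -lt0n fact_gt0.
Qed.

End Permanent.

(** * Hellinger affinity *)

Section Hellinger.
Local Open Scope classical_set_scope.
Local Open Scope ring_scope.
Local Open Scope charge_scope.
Local Open Scope ereal_scope.
Context d (T : measurableType d) (R : realType).
Implicit Types P Q : probability T R.

Lemma integral_density_in P Q f (g : T -> \bar R) E : has_density P Q f ->
  measurable E -> measurable_fun setT g -> (forall x, 0 <= g x) ->
  \int[P]_(x in E) g x = \int[Q]_(x in E) (g x * (f x)%:E).
Proof.
move=> hd mE mg g0; rewrite integral_mkcond [RHS]integral_mkcond.
rewrite (integral_density hd).
- by apply: eq_integral => x _; rewrite /patch; case: ifP; rewrite ?mul0e.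
- by apply/(measurable_restrictT _ mE); exact: measurable_funTS.
- by move=> x; rewrite /patch; case: ifP.
Qed.

Variables (P1 P2 Q : probability T R) (f1 f2 : T -> R).
Hypothesis hd1 : has_density P1 Q f1.
Hypothesis hd2 : has_density P2 Q f2.
Hypothesis bf1 : bounded_mfun f1.
Hypothesis bf2 : bounded_mfun f2.

Let f10 x : (0 <= f1 x)%R. Proof. by case: hd1. Qed.
Let f20 x : (0 <= f2 x)%R. Proof. by case: hd2. Qed.

Let mu := measure_add P1 P2.

(* The measure that defines the Hellinger distance has density [f1 + f2] with
   respect to [Q]; this transports the computation to [Q]. *)
Let integral_mu E (g : T -> \bar R) :
  measurable E -> measurable_fun setT g -> (forall x, 0 <= g x) ->
  \int[mu]_(x in E) g x = \int[Q]_(x in E) (g x * (f1 x + f2 x)%:E).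
Proof.
move=> mE mg g0; rewrite ge0_integral_measure_add //; last exact: measurable_funTS.
have mEf1 : measurable_fun E (EFin \o f1) by apply/measurable_EFinP/measurable_funTS; case: bf1.
have mEf2 : measurable_fun E (EFin \o f2) by apply/measurable_EFinP/measurable_funTS; case: bf2.
rewrite (integral_density_in hd1) // (integral_density_in hd2) //.
rewrite -ge0_integralD //.
- by apply: eq_integral => x _; rewrite EFinD ge0_muleDr // lee_fin.
- by move=> x _; rewrite mule_ge0 // lee_fin.
- by apply: emeasurable_funM => //; exact: measurable_funTS.
- by move=> x _; rewrite mule_ge0 // lee_fin.
- by apply: emeasurable_funM => //; exact: measurable_funTS.
Qed.

Let dom (P : probability T R) : (forall A, P A <= mu A) -> P `<< mu.
Proof.
move=> Pmu A nA B mB BA; have := Pmu B; rewrite (nA B mB BA).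
by rewrite measure_le0 => /eqP.
Qed.

Let dom1 : P1 `<< mu.
Proof. by apply: dom => A; rewrite /mu measure_addE leeDl. Qed.

Let dom2 : P2 `<< mu.
Proof. by apply: dom => A; rewrite /mu measure_addE leeDr. Qed.

Let rn P x := Radon_Nikodym_SigmaFinite.f P mu x.

Let rn_prop P (PQ : P `<< mu) : [/\ measurable_fun setT (rn P),
  forall x, 0 <= rn P x, forall x, rn P x \is a fin_num &
  ae_eq mu setT (rn P) ('d (charge_of_finite_measure P) '/d mu)].
Proof.
split.
- exact: measurable_int (Radon_Nikodym_SigmaFinite.f_integrable PQ).
- exact: Radon_Nikodym_SigmaFinite.f_ge0.
- exact: Radon_Nikodym_SigmaFinite.f_fin_num.
- exact: ae_eq_Radon_Nikodym_SigmaFinite.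
Qed.

Let rn_ae P f : P `<< mu -> has_density P Q f -> bounded_mfun f ->
  ae_eq Q setT (EFin \o f) (fun x => rn P x * (f1 x + f2 x)%:E).
Proof.
move=> PQ hd bf; have [mr r0 rfin _] := rn_prop PQ.
apply: integral_ae_eq => //.
- exact: bmfun_int.
- apply: emeasurable_funM => //; apply/measurable_EFinP.
  by apply: measurable_funD; [case: bf1|case: bf2].
- move=> E _ mE; rewrite -integral_mu //.
  rewrite -(Radon_Nikodym_SigmaFinite.f_integral PQ) //.
  by case: hd => _ _ /(_ E mE) h; exact: esym.
Qed.

Lemma hellinger2_density :
  hellinger2 P1 P2 = (2 - 2 * \int[Q]_x Num.sqrt (f1 x * f2 x))%R%:E.
Proof.
have [m1 p0 pfin pae] := rn_prop dom1; have [m2 q0 qfin qae] := rn_prop dom2.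
have mfine (g : T -> \bar R) : measurable_fun setT g -> measurable_fun setT (fine \o g).
  by move=> mg; exact: measurableT_comp.
have mdiff (g h : T -> \bar R) : measurable_fun setT g -> measurable_fun setT h ->
    measurable_fun setT (fun x => ((Num.sqrt (fine (g x)) - Num.sqrt (fine (h x))) ^+ 2)%:E).
  move=> mg mh; apply/measurable_EFinP; apply: measurable_funX.
  by apply: measurable_funB; apply: measurable_sqrt; exact: mfine.
have mD P : P `<< mu -> measurable_fun setT ('d (charge_of_finite_measure P) '/d mu).
  by move=> PQ; apply: measurable_int; exact: Radon_Nikodym_integrable.
rewrite /hellinger2 /= -/mu.
transitivity (\int[mu]_x ((Num.sqrt (fine (rn P1 x)) - Num.sqrt (fine (rn P2 x))) ^+ 2)%:E).
  apply: ae_eq_integral => //.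
  - by apply: mdiff; exact: mD.
  - exact: mdiff.
  by apply: filterS2 pae qae => x e1 e2 _; rewrite e1 // e2.
rewrite integral_mu //; last 2 first.
- exact: mdiff.
- by move=> x; rewrite lee_fin sqr_ge0.
transitivity (\int[Q]_x ((Num.sqrt (f1 x) - Num.sqrt (f2 x)) ^+ 2)%:E).
  have mf1 : measurable_fun setT f1 by case: bf1.
  have mf2 : measurable_fun setT f2 by case: bf2.
  apply: ae_eq_integral => //.
  - apply: emeasurable_funM; first exact: mdiff.
    by apply/measurable_EFinP; exact: measurable_funD.
  - apply/measurable_EFinP; apply: measurable_funX.
    by apply: measurable_funB; exact: measurable_sqrt.
  apply: filterS2 (rn_ae dom1 hd1 bf1) (rn_ae dom2 hd2 bf2) => x /= e1 e2 _.
  have h0 : (0 <= f1 x + f2 x)%R by exact: addr_ge0.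
  have -> : Num.sqrt (f1 x) = (Num.sqrt (fine (rn P1 x)) * Num.sqrt (f1 x + f2 x))%R.
    rewrite -sqrtrM ?fine_ge0 //; congr Num.sqrt; apply: EFin_inj.
    by rewrite EFinM fineK //; exact: e1.
  have -> : Num.sqrt (f2 x) = (Num.sqrt (fine (rn P2 x)) * Num.sqrt (f1 x + f2 x))%R.
    rewrite -sqrtrM ?fine_ge0 //; congr Num.sqrt; apply: EFin_inj.
    by rewrite EFinM fineK //; exact: e2.
  by rewrite -mulrBl exprMn sqr_sqrtr // EFinM.
have bs12 : bounded_mfun (fun x => Num.sqrt (f1 x * f2 x)).
  by apply: bmfun_sqrt; [exact: bmfunM|move=> x; exact: mulr_ge0].
transitivity (\int[Q]_x (f1 x + f2 x + - 2 * Num.sqrt (f1 x * f2 x))%R%:E).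
  apply: eq_integral => x _; congr EFin.
  by rewrite sqrrB !sqr_sqrtr // sqrtrM //; ring.
rewrite bmfun_EFin; last by apply: bmfunD; [exact: bmfunD|exact: bmfunZ].
congr EFin; rewrite RintD; [|exact: bmfunD|exact: bmfunZ].
rewrite RintD // RintZ //.
have e g P : has_density P Q g -> bounded_mfun g -> (\int[Q]_x g x = 1)%R.
  by move=> hd bg; apply: EFin_inj; rewrite -bmfun_EFin // (density_total hd).
rewrite (e _ _ hd1) // (e _ _ hd2) //; ring.
Qed.

Lemma renyi_half_affinity (v : R) : renyi_half P1 P2 <= v%:E ->
  (expR (- v) <= (\int[Q]_x Num.sqrt (f1 x * f2 x)) ^+ 2)%R.
Proof.
rewrite /renyi_half hellinger2_density; set a := (\int[Q]_x _)%R.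
have a0 : (0 <= a)%R by apply: Rintegral_ge0 => x _; exact: sqrtr_ge0.
have -> : 1 - (2 - 2 * a)%R%:E * (2^-1)%:E = a%:E.
  by rewrite -EFinM -EFinB; congr EFin; field.
have [->|an] := eqVneq a 0%R.
  by rewrite le0_lneNy // lt0_muleNy ?lte_fin ?oppr_lt0 // leye_eq.
have ap : (0 < a)%R by rewrite lt_neqAle eq_sym an.
rewrite lne_EFin // -EFinM lee_fin => h.
rewrite -[leRHS]lnK ?posrE ?exprn_gt0 // ler_expR lnXn // mulr2n; lra.
Qed.

End Hellinger.

(** * The chi-square capacity bounds the trace of the overlap matrix *)

Section Capacity.
Local Open Scope classical_set_scope.
Local Open Scope ring_scope.
Local Open Scope ereal_scope.
Context d (T : measurableType d) (R : realType).

Lemma chi2_ge0 (P Q : probability T R) : 0 <= chi2 P Q.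
Proof.
by rewrite /chi2; case: ifP => // _; apply: integral_ge0 => x _; exact: sqre_ge0.
Qed.

(** The laws with the discrete sigma-algebra, for which every parametrization
    is measurable. *)
Definition discrete_law : Type :=
  g_sigma_algebraType [set: set (pprobability T R)].

HB.instance Definition _ := Measurable.on discrete_law.

Lemma discrete_measurable_law (Y : set discrete_law) : measurable Y.
Proof. exact: sub_sigma_algebra. Qed.

(** The capacity quantifies over parametrizations of the whole class, while the
    prior only charges [P_1, ..., P_N]: the class is parametrized by all laws,
    those outside the class being sent to [P ord0]. *)
Lemma chi2_capacity_ge n (P : 'I_n.+1 -> probability T R) (F : set (probability T R))
    (f : 'I_n.+1 -> T -> R) :
  (forall i, F (P i)) ->
  (forall i, has_density (P i) (uniform_mixture ord0 P) (f i)) ->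
  (forall i, bounded_mfun (f i)) ->
  (\sum_i overlap P f i i - 1)%R%:E <= chi2_capacity F.
Proof.
move=> FP hd bf; set nu : probability T R := uniform_mixture ord0 P.
pose p0 (Q : discrete_law) : pprobability T R :=
  if `[< F (Q : probability T R) >] then Q else P ord0.
have mp : measurable_fun setT p0.
  by move=> _ Y _; exact: discrete_measurable_law.
pose p : {mfun discrete_law >-> pprobability T R} := mfun_Sub (mem_set mp).
have pE (Q : discrete_law) : p Q = p0 Q by [].
have p0P i : p0 (P i : pprobability T R) = P i by rewrite /p0 asboolT.
pose rho : probability discrete_law R :=
  uniform_mixture ord0 (fun i : 'I_n.+1 => \d_(P i : discrete_law) : probability _ R).
have rhoE (g : discrete_law -> \bar R) : (forall Q, 0 <= g Q) ->
    \int[rho]_Q g Q = (n.+1%:R^-1)%:E * \sum_i g (P i : discrete_law).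
  move=> g0; have mg : measurable_fun setT g.
    by move=> _ Y _; exact: discrete_measurable_law.
  rewrite integral_uniform_mixture //; congr (_ * _); apply: eq_bigr => i _.
  by rewrite integral_dirac // diracT mul1e.
have pmE A : measurable A -> prior_mean p rho A = nu A.
  move=> mA; rewrite /prior_mean rhoE; last by move=> Q; exact: measure_ge0.
  transitivity ((n.+1%:R^-1)%:E * \sum_i P i A).
    congr (_ * _); apply: eq_bigr => i _.
    exact: (congr1 (fun Q : probability T R => Q A) (p0P i)).
  by rewrite /nu /= /uniform_mixture card_ord.
have chE i : chi2 (P i) (prior_mean p rho) = (\int[nu]_x (f i x ^+ 2) - 1)%R%:E.
  have hd' : has_density (P i) (prior_mean p rho) (f i).
    have [mf f0 PE] := hd i; split=> // A mA; rewrite PE //.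
    by apply: eq_measure_integral => B mB _; apply: esym; exact: pmE.
  have := chi2_density hd'; rewrite (@eq_measure_integral _ _ _ _ nu); last first.
    by move=> B mB _; exact: pmE.
  rewrite bmfun_EFin; last exact: bmfunM.
  have := chi2_ge0 (P i) (prior_mean p rho); case: chi2 => [r| |] // _.
  by rewrite -EFinD => -[<-]; congr EFin; rewrite addrAC subrr add0r.
apply: ereal_sup_ubound; exists _, discrete_law, p, rho; split.
  apply/seteqP; split => [_ [Q _ <-]|Q FQ].
    by rewrite pE /p0; case: ifP => [/asboolP|_].
  by exists (Q : discrete_law) => //; rewrite pE /p0 asboolT.
rewrite rhoE; last by move=> Q; exact: chi2_ge0.
rewrite (eq_bigr (fun i => (\int[nu]_x (f i x ^+ 2) - 1)%R%:E)); last first.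
  move=> i _; rewrite -chE.
  exact: (congr1 (fun Q : probability T R => chi2 Q (prior_mean p rho)) (p0P i)).
rewrite sumEFin -EFinM; congr EFin.
by rewrite sumrB sumr_const card_ord /overlap -big_distrr /= mulrBr mulVf ?pnatr_eq0.
Qed.

End Capacity.

(** * Assembling the bound *)

Section Final.
Local Open Scope classical_set_scope.
Local Open Scope ring_scope.
Local Open Scope ereal_scope.
Context d (T : measurableType d) (R : realType).
Implicit Type F : set (probability T R).

Lemma partition_diameter_ge0 k F : 0 <= partition_diameter k F.
Proof. by apply: le_ereal_inf_tmp => _ [G [_ _ ->]]; exact: bigmax_ge_id. Qed.

Lemma lne_le_expR (x : \bar R) (y : R) : x <= (expR y)%:E -> lne x <= y%:E.
Proof.
case: x => [r| |]; rewrite ?leye_eq ?leNye //= lee_fin => re; case: ifPn => [_|]; first exact: leNye.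
by rewrite -ltNge => r0; rewrite lee_fin -[leRHS]expRK ler_ln ?posrE ?expR_gt0.
Qed.

Section mixture.
Variables (n : nat) (P : 'I_n.+1 -> probability T R) (F : set (probability T R)).
Hypothesis FP : forall i, F (P i).
Let nu : probability T R := uniform_mixture ord0 P.
Variable f : 'I_n.+1 -> T -> R.
Hypothesis hd : forall i, has_density (P i) nu (f i).
Hypothesis fsum : forall x, (\sum_i f i x = n.+1%:R)%R.
Hypothesis bf : forall i, bounded_mfun (f i).

(** Labelling each component by a part that contains it turns the partition of
    the class into blocks of indices. *)
Lemma overlap_form_partition k (G : 'I_k -> set (probability T R)) (v : R) :
  \bigcup_i G i = F ->
  (forall l Q Q', G l Q -> G l Q' -> renyi_half Q Q' <= v%:E) ->
  exists S : 'I_n.+1 -> 'I_k, forall x : 'I_n.+1 -> R,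
    (forall l, \sum_(i | S i == l) x i = 0)%R ->
    (\sum_i \sum_j overlap P f i j * (x i * x j) <=
     (1 - expR (- v)) * \sum_i x i ^+ 2)%R.
Proof.
move=> GF Gv.
have ex i : exists l, G l (P i).
  by have := FP i; rewrite -GF => -[l _ Gl]; exists l.
have [S GS] := choice ex.
exists S => x x0; apply: (block_overlap_form_le hd fsum _ x0) => i j /eqP ij.
apply: (renyi_half_affinity (hd i) (hd j) (bf i) (bf j)).
by apply: (Gv (S i)) => //; rewrite -ij.
Qed.

(** Summing to zero over each of the [k] parts amounts to [k] linear conditions,
    so that the form bound on this subspace reaches the eigenvalue of index
    [k]. *)
Lemma eigenvalue_le_diameter (lam : 'I_n.+1 -> R) (k : 'I_n.+1) :
  (forall (k : 'I_n.+1) (L : 'I_k -> 'I_n.+1 -> R) (mu : R),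
    (forall x : 'I_n.+1 -> R, (forall l, \sum_i L l i * x i = 0) ->
      \sum_i \sum_j overlap P f i j * (x i * x j) <= mu * \sum_i x i ^+ 2) ->
    lam k <= mu)%R ->
  - lne (1 - lam k)%R%:E <= partition_diameter k F.
Proof.
move=> cf; apply: le_ereal_inf_tmp => _ [G [GF _ ->]].
set v := \big[_/_]_(i < k) _.
have v0 : 0 <= v by exact: bigmax_ge_id.
have Gv l Q Q' : G l Q -> G l Q' -> renyi_half Q Q' <= v.
  move=> GQ GQ'; apply: (bigmax_sup l) => //.
  by apply: ereal_sup_ubound; exists Q => //; exists Q'.
move: v v0 Gv => [v| |] // v0 Gv; last by rewrite leey.
have [S SP] := overlap_form_partition GF Gv.
have le1 : (lam k <= 1 - expR (- v))%R.
  apply: (cf k (fun l i => (S i == l)%:R)%R) => x x0; apply: SP => l.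
  apply: etrans (x0 l); rewrite big_mkcond /=; apply: eq_bigr => i _.
  by case: eqP; rewrite ?mul1r ?mul0r.
have ep := expR_gt0 (- v).
have lp : (0 < 1 - lam k)%R by lra.
rewrite lne_EFin // -EFinN lee_fin lerNl -[leLHS]expRK ler_ln ?posrE //; lra.
Qed.

End mixture.

Lemma chi2_mixture_bound n (P : 'I_n.+1 -> probability T R) F (c : R) :
  (forall i, F (P i)) -> chi2_capacity F = c%:E ->
  (forall k, (0 < k < (Num.truncn c).+2)%N -> partition_diameter k F < +oo) ->
  1 + chi2 (permutation_mixture P) (mean_field P) <=
  (expR (\sum_(1 <= k < (Num.truncn c).+2) fine (partition_diameter k F) + 5 * (c + 1)))%:E.
Proof.
move=> FP Fc Dfin; have [f [hd fsum]] := mixture_densities P.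
have bf := density_bounded hd fsum.
have trc : (\sum_i overlap P f i i <= c + 1)%R.
  have := chi2_capacity_ge FP hd bf; rewrite Fc lee_fin; lra.
have symA := overlapC P f.
have [lam [lam0 lamS trl cf pb]] :=
  spectral_permanent_bound symA (overlap_psd hd fsum).
have lam01 : (lam ord0 <= 1)%R.
  apply: (cf ord0 (fun=> fun=> 0%R)) => x _; rewrite mul1r.
  exact: overlap_form_le.
have lam1 k : (0 <= lam k <= 1)%R.
  by rewrite lam0 (le_trans _ lam01) // lamS.
have tr1 := overlap_trace_ge1 hd fsum.
have c0 : (0 <= c)%R by lra.
have mc : ((Num.truncn c)%:R <= c)%R by rewrite truncn_le.
have cm : (c < (Num.truncn c).+1%:R)%R by rewrite -truncn_le_nat.
pose D k := fine (partition_diameter k F).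
have D0 k : (0 <= D k)%R by rewrite fine_ge0 // partition_diameter_ge0.
have gap (k : 'I_n.+1) : (0 < k < (Num.truncn c).+2)%N ->
    (lam k < 1)%R /\ ((1 - lam k)^-1 <= expR (D k))%R.
  move=> km; have := eigenvalue_le_diameter FP hd fsum bf k cf.
  have Dk : partition_diameter k F = (D k)%:E.
    by rewrite /D fineK // ge0_fin_numE ?partition_diameter_ge0 // Dfin.
  rewrite Dk; have [lt1|ge1] := ltP (lam k) 1%R; last first.
    by rewrite le0_lneNy ?lee_fin ?subr_le0 //= leye_eq.
  have lp : (0 < 1 - lam k)%R by rewrite subr_gt0.
  rewrite lne_EFin // -EFinN lee_fin => h; split => //.
  by rewrite -[leLHS]lnK ?posrE ?invr_gt0 // ler_expR lnV.
have lt1 (i : 'I_n) : (lam (lift ord0 i) < 1)%R.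
  set k : 'I_n.+1 := lift ord0 i.
  have [km|mk] := ltnP k (Num.truncn c).+2.
    by have [] : (lam k < 1)%R /\ ((1 - lam k)^-1 <= expR (D k))%R by exact: gap.
  have := antitone_le_sum k lam0 lamS; rewrite trl => h.
  have ck : (c + 1 < k.+1%:R)%R.
    rewrite -natr1 ltrD2r (lt_le_trans cm) // ler_nat; exact: ltnW.
  rewrite -(ltr_pM2l (_ : 0 < k.+1%:R)%R) ?ltr0n // mulr1; lra.
rewrite (chi2_permanent hd bf) lee_fin.
apply: le_trans (eigenvalue_product_bound mc cm lam1 lamS _ D0 (fun k km => (gap k km).2)); last first.
  by rewrite trl.
rewrite mulrAC ler_pdivrMr ?ltr0n ?fact_gt0 // [leRHS]mulrC.
exact: pb.
Qed.

Lemma chi2_capacity_ge0 F : F !=set0 -> 0 <= chi2_capacity F.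
Proof.
move=> [Q FQ]; pose P (i : 'I_1) := Q; have [f [hd fsum]] := mixture_densities P.
apply: le_trans (chi2_capacity_ge (fun=> FQ) hd (density_bounded hd fsum)).
by rewrite lee_fin subr_ge0 overlap_trace_ge1.
Qed.

Lemma log_plus_ge1 (x : \bar R) : 1 <= log_plus x.
Proof.
rewrite /log_plus; have : (expR 1)%:E <= maxe x (expR 1)%:E by rewrite le_max lexx orbT.
case: maxe => [r|_|]; last by rewrite leeNy_eq.
  rewrite lee_fin => er; have r0 := lt_le_trans (expR_gt0 1) er.
  by rewrite lne_EFin // lee_fin -[leLHS]expRK ler_ln ?posrE ?expR_gt0.
by rewrite /= leey.
Qed.

Lemma lne_chi2_class_bound F : F !=set0 ->
  lne (1 + chi2_class F) <=
    5%:E * (partition_diameter_sum F +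
      (chi2_capacity F + 1) * log_plus (lne (chi2_capacity F))).
Proof.
move=> F0; have C0 := chi2_capacity_ge0 F0.
have lp1 := log_plus_ge1 (lne (chi2_capacity F)).
have S0 : 0 <= partition_diameter_sum F.
  rewrite /partition_diameter_sum; case: chi2_capacity => [c| |].
  - by apply: sume_ge0 => k _; exact: partition_diameter_ge0.
  - by apply: nneseries_ge0 => k _ _; exact: partition_diameter_ge0.
  - by apply: nneseries_ge0 => k _ _; exact: partition_diameter_ge0.
have le_rhs : 5%:E * (partition_diameter_sum F + (chi2_capacity F + 1)) <=
    5%:E * (partition_diameter_sum F +
      (chi2_capacity F + 1) * log_plus (lne (chi2_capacity F))).
  by rewrite lee_pmul2l // leeD2l // lee_pemulr // adde_ge0.
apply: le_trans le_rhs.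
case Fc : (chi2_capacity F) C0 => [c| |] // C0; last first.
  by rewrite addye // addey ?gt0_muley ?leey // gt_eqF // (lt_le_trans _ S0).
have [Soo|Sfin] := eqVneq (partition_diameter_sum F) +oo.
  by rewrite Soo addye // gt0_muley ?leey.
have SE : partition_diameter_sum F =
    \sum_(1 <= k < (Num.truncn c).+2) partition_diameter k F.
  by rewrite /partition_diameter_sum Fc.
have Dfin k : (0 < k < (Num.truncn c).+2)%N -> partition_diameter k F < +oo.
  move=> km; apply: (@le_lt_trans _ _ (partition_diameter_sum F)); last by rewrite ltey.
  rewrite SE (bigD1_seq k) ?iota_uniq ?mem_index_iota //=.
  by rewrite leeDl // sume_ge0 // => j _; exact: partition_diameter_ge0.
pose y := (\sum_(1 <= k < (Num.truncn c).+2) fine (partition_diameter k F) + 5 * (c + 1))%R.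
apply: (@le_trans _ _ y%:E).
  apply: lne_le_expR.
  have : chi2_class F <= (expR y - 1)%:E.
    apply: ge_ereal_sup => _ [n [P [FP ->]]].
    have := chi2_mixture_bound FP Fc Dfin; rewrite -/y.
    have := chi2_ge0 (permutation_mixture P) (mean_field P).
    by case: chi2 => [r| |] // _; rewrite -EFinD !lee_fin => h; lra.
  case: chi2_class => [r| |]; rewrite ?leye_eq ?addeNy ?leNye //.
  by rewrite -EFinD !lee_fin => h; lra.
have -> : partition_diameter_sum F =
    (\sum_(1 <= k < (Num.truncn c).+2) fine (partition_diameter k F))%R%:E.
  rewrite SE -sumEFin big_nat [RHS]big_nat; apply: eq_bigr => k km.
  by rewrite fineK // ge0_fin_numE ?partition_diameter_ge0 // Dfin.
rewrite -!EFinD -EFinM lee_fin /y [leRHS]mulrDr lerD2r ler_peMl ?ler1n //.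
by apply: sumr_ge0 => k _; rewrite fine_ge0 // partition_diameter_ge0.
Qed.

End Final.

Unset Implicit Arguments.
Local Open Scope classical_set_scope.
Local Open Scope ring_scope.
Local Open Scope ereal_scope.

Theorem theorem1p3 (R : realType) :
  exists2 C : R, (0 < C)%R &
    forall (d : measure_display) (T : measurableType d)
        (F : set (probability T R)), F !=set0 ->
      lne (1 + chi2_class F) <=
        C%:E * (partition_diameter_sum F +
                (chi2_capacity F + 1) * log_plus (lne (chi2_capacity F))).
Proof.
by exists 5%R => // d T F; exact: lne_chi2_class_bound.
Qed.
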